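(* Let $n\ge 2$, let $a_1,\dots,a_n$ be positive integers, and let $K(\Omega)$ be the $2$-bridge link generated by the word $\Omega = R^{a_1}L^{a_2}\cdots(R^{a_n}\mid L^{a_n})$. Let $\mathcal{T}=\mathcal{T}(M)$ be the Sakuma-Weeks triangulation of the complement $M=S^3\setminus K(\Omega)$. Then $\mathcal{T}$ is minimal only if $a_1=a_n=1$ and $a_i\in\{1,2\}$ for all $1<i<n$.
   Context: Words. Words are in the letters $R,L$; $(R^{a_n}\mid L^{a_n})$ means either $R^{a_n}$ or $L^{a_n}$, whichever continues the alternation of $R$-syllables and $L$-syllables. The link $K(\Omega)$. Reading $\Omega$ from the outside in, form a four-string braid between an outer and an inner pillowcase (sphere with four marked points): each $R$ is a crossing between the top two strands and each $L$ a crossing between the right two strands, with signs such that the diagram is alternating. Then add two arcs with a single crossing connecting opposite pairs of marked points on the outer pillowcase and likewise two arcs with a single crossing on the inner pillowcase, so that the diagram is alternating. For $n\ge 2$, up to mirror image, $K(\Omega)$ is the $2$-bridge link with Conway notation $C(a_1+1,a_2,\dots,a_{n-1},a_n+1)$. It is hyperbolic. Minimality. The complexity $c(M)$ is the minimal number of ideal tetrahedra in an ideal triangulation of $M$ (generalised triangulations, in which faces of the same tetrahedron may be glued to each other, are allowed; $M$ is the triangulated space with vertices removed). An ideal triangulation of $M$ is minimal if it has exactly $c(M)$ tetrahedra. Sakuma-Weeks triangulation. Let $\Omega=w_1w_2\cdots w_\ell$ be the letters of $\Omega$, $w_1=R$, $\ell=\sum a_i$. Let $S$ be the four-punctured sphere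 $(\mathbb{R}^2\setminus\mathbb{Z}^2)/\Gamma$, $\Gamma$ generated by the $\pi$-rotations about points of $\mathbb{Z}^2$. Each slope in $\mathbb{Q}\cup\{\infty\}$ determines two disjoint ideal arcs of $S$; three slopes spanning a Farey triangle determine an ideal triangulation of $S$ with six edges and four triangles. Define slopes $h_i,v_i,d_i,d_i'$ ($1\le i\le \ell-1$) by $h_1=0$, $v_1=\infty$, $d_1=-1$, $d_1'=1$, and for $i\ge1$: if $w_{i+1}=R$ then $h_{i+1}=h_i$, $v_{i+1}=d_i'$, $d_{i+1}=v_i$; if $w_{i+1}=L$ then $v_{i+1}=v_i$, $h_{i+1}=d_i'$, $d_{i+1}=h_i$; in both cases $d_{i+1}'\neq d_{i+1}$ is the other slope forming a Farey triangle with $h_{i+1},v_{i+1}$. Layer $i$ consists of two ideal tetrahedra realising the diagonal exchange from the triangulation of $S$ with slopes $\{h_i,v_i,d_i\}$ to the one with slopes $\{h_i,v_i,d_i'\}$; consecutive layers are glued along their common triangulated copy of $S$. The four outer faces of layer $1$ are glued in pairs by folding along the edges of slope $v_1$ (two triangles sharing an edge of slope $v_1$ are identified by the map fixing that edge and exchanging the opposite vertices). The four inner faces of layer $\ell-1$ are glued in pairs in the same way by folding along the edges of slope $v_{\ell-1}$ if $w_\ell=R$, and along those of slope $h_{\ell-1}$ if $w_\ell=L$. The result is an ideal triangulation of $S^3\setminus K(\Omega)$ with $2(\ell-1)$ ideal tetrahedra. *)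

(* Defs.v *)
From HB Require Import structures.
From mathcomp Require Import all_boot all_order all_fingroup all_algebra.
From mathcomp Require Import zify.
From mathcomp Require Import all_classical all_reals all_analysis.
From mathcomp Require Import generic_quotient.
From Stdlib Require Import Relation_Operators.

Set Implicit Arguments.
Unset Strict Implicit.
Unset Printing Implicit Defensive.

Import Order.TTheory GRing.Theory Num.Theory.
Import numFieldNormedType.Exports.

Local Open Scope classical_set_scope.
Local Open Scope ring_scope.
Local Open Scope quotient_scope.

(** * Generalised ideal triangulations *)

(* Every tetrahedron has vertices 'I_4, and face f is the face opposite vertex
   f.  [glue t f = (u, s)] means that face f of t is identified with face s f
   of u by the affine map sending vertex k to vertex s k for k != f.  All faces
   are paired; faces of a single tetrahedron may be glued to each other, but no
   face is glued to itself. *)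
Record triangulation := Triangulation {
  tet : finType;
  glue : tet -> 'I_4 -> tet * 'S_4;
  glueK : forall t f,
    glue (glue t f).1 ((glue t f).2 f) = (t, ((glue t f).2)^-1%g);
  glue_free : forall t f, ((glue t f).1, (glue t f).2 f) <> (t, f)
}.

(* Barycentric coordinates; the condition x 0 k < 1 removes the vertices. *)
Definition ideal_tetrahedron (R : realType) : set 'rV[R]_4 :=
  [set x | (forall k, 0 <= x 0 k < 1) /\ \sum_k x 0 k = 1].

Definition pieces (R : realType) (T : triangulation) : topologicalType :=
  {t : tet T & set_type (@ideal_tetrahedron R)}.

Definition bary (R : realType) (T : triangulation) (p : pieces R T) : 'rV[R]_4 :=
  set_val (projT2 p).

Definition face_identified (R : realType) (T : triangulation)
    (p q : pieces R T) : Prop :=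
  exists f : 'I_4,
    [/\ bary p 0 f = 0,
        projT1 q = (glue (projT1 p) f).1 &
        forall k, bary q 0 ((glue (projT1 p) f).2 k) = bary p 0 k].

Definition identified (R : realType) (T : triangulation) : rel (pieces R T) :=
  fun p q => `[< clos_refl_sym_trans _ (@face_identified R T) p q >].

Lemma identified_equiv (R : realType) (T : triangulation) :
  equiv_class_of (@identified R T).
Proof.
split.
- by move=> x; apply/asboolP; exact: rst_refl.
- by move=> x y; apply/asboolP/asboolP; exact: rst_sym.
- move=> y x z /asboolP xy /asboolP yz; apply/asboolP.
  exact: rst_trans xy yz.
Qed.

Canonical identified_equiv_rel (R : realType) (T : triangulation) :=
  EquivRelPack (@identified_equiv R T).

(* The triangulated space with its vertices removed. *)
Definition realization (R : realType) (T : triangulation) : topologicalType :=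
  quotient_topology {eq_quot @identified_equiv_rel R T}.

Definition homeomorphic (X Y : topologicalType) : Prop :=
  exists (f : X -> Y) (g : Y -> X),
    [/\ continuous f, continuous g, cancel f g & cancel g f].

Definition ideal_triangulation_of (R : realType) (M : topologicalType)
    (T : triangulation) : Prop :=
  homeomorphic (realization R T) M.

Definition is_complexity (R : realType) (M : topologicalType) (c : nat) : Prop :=
  (exists2 T, ideal_triangulation_of R M T & #|tet T| = c) /\
  (forall T, ideal_triangulation_of R M T -> (c <= #|tet T|)%N).

Definition minimal_ideal_triangulation (R : realType) (M : topologicalType)
    (T : triangulation) : Prop :=
  ideal_triangulation_of R M T /\ is_complexity R M #|tet T|.

(** * Words *)

Inductive letter := Rlet | Llet.

Definition is_R (c : letter) : bool := if c is Rlet then true else false.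

(* R^(a 1) L^(a 2) R^(a 3) ... with n syllables. *)
Definition alternating_word (n : nat) (a : nat -> nat) : seq letter :=
  flatten [seq nseq (a i) (if odd i then Rlet else Llet) | i <- iota 1 n].

(** * The link of a word *)

Section Link.
Variable R : realType.

Definition pt (x y z : R) : 'rV[R]_3 := \row_j nth 0 [:: x; y; z] j.

Definition edge (p q : 'rV[R]_3) : set 'rV[R]_3 :=
  [set (1 - t) *: p + t *: q | t in `[0, 1]].

Fixpoint polyline (p : 'rV[R]_3) (s : seq 'rV[R]_3) : set 'rV[R]_3 :=
  if s is q :: s' then edge p q `|` polyline q s' else set0.

(* The pillowcase at level t meets the plane z = 0 of the diagram in the square
   of half-side t, with the four marked points at its corners. *)
Definition NW (t : R) := pt (- t) t 0.
Definition NE (t : R) := pt t t 0.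
Definition SE (t : R) := pt t (- t) 0.
Definition SW (t : R) := pt (- t) (- t) 0.

(* The part of the braid between the pillowcases at levels t and t - 1, for
   t >= 2; at a crossing the strand with z > 0 is the overstrand.  The SW
   strand never crosses the others, and on the positions NW, NE, SE the letters
   R and L act as the braid generators s_1 and s_2^-1, so that the braid is
   alternating. *)
Definition braid_layer (c : letter) (t : R) : set 'rV[R]_3 :=
  let t' := t - 1 in
  let m := t - 2^-1 in
  polyline (SW t) [:: SW t'] `|`
  match c with
  | Rlet => polyline (NW t) [:: pt 0 m 1; NE t'] `|`
            polyline (NE t) [:: pt 0 m (-1); NW t'] `|`
            polyline (SE t) [:: SE t']
  | Llet => polyline (SE t) [:: pt m 0 1; NE t'] `|`
            polyline (NE t) [:: pt m 0 (-1); SE t'] `|`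
            polyline (NW t) [:: NW t']
  end.

(* Letters are read from the outside in; the innermost pillowcase is at level
   1 and the outermost one at level (size w).+1. *)
Fixpoint braid (w : seq letter) : set 'rV[R]_3 :=
  if w is c :: w' then braid_layer c (size w).+1%:R `|` braid w' else set0.

(* Inner arcs NW-SE and NE-SW, crossing at the centre. *)
Definition inner_arcs : set 'rV[R]_3 :=
  polyline (NW 1) [:: pt 0 0 1; SE 1] `|`
  polyline (NE 1) [:: pt 0 0 (-1); SW 1].

(* Outer arcs NW-SE and SW-NE, outside the square of half-side t, crossing
   over the point (2t, 0); the signs of the inner and outer crossings make the
   closed diagram alternating when the word starts with R. *)
Definition outer_arcs (t : R) : set 'rV[R]_3 :=
  polyline (NW t) [:: pt (2 * t) (2 * t) 0; pt (2 * t) 0 (-1); SE t] `|`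
  polyline (SW t) [:: pt (2 * t) (- (2 * t)) 0; pt (2 * t) 0 1; NE t].

Definition link_R3 (w : seq letter) : set 'rV[R]_3 :=
  outer_arcs (size w).+1%:R `|` braid w `|` inner_arcs.

Definition sphere3 : set 'rV[R]_4 := [set x | \sum_k x 0 k ^+ 2 = 1].

(* Inverse stereographic projection R^3 -> S^3. *)
Definition inv_stereo (x : 'rV[R]_3) : 'rV[R]_4 :=
  let r := \sum_k x 0 k ^+ 2 in
  row_mx ((2 / (r + 1)) *: x) ((r - 1) / (r + 1))%:M : 'rV[R]_(3 + 1).

Definition link (w : seq letter) : set 'rV[R]_4 := inv_stereo @` link_R3 w.

Definition link_complement (w : seq letter) : topologicalType :=
  set_type (sphere3 `\` link w).

End Link.

(** * The Sakuma-Weeks triangulation *)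

(* The slope p/q in Q u {oo} is represented by either of the primitive vectors
   (q, p), (-q, -p); two slopes span an edge of the Farey graph iff their
   vectors have determinant 1 or -1, and the third vertices of the two Farey
   triangles on that edge are then the sum and the difference of the vectors. *)
Definition vec := (int * int)%type.

Record slopes := Slopes { slope_h : vec; slope_v : vec; slope_d : vec }.

(* The vertex other than d completing h and v to a Farey triangle. *)
Definition other_slope (h v d : vec) : vec :=
  if (d == h + v) || (d == - (h + v)) then h - v else h + v.

Definition slope_d' (s : slopes) : vec :=
  other_slope (slope_h s) (slope_v s) (slope_d s).

Definition slopes1 : slopes := Slopes (1, 0) (0, 1) (1, -1).

Definition next_slopes (s : slopes) (c : letter) : slopes :=
  match c with
  | Rlet => Slopes (slope_h s) (slope_d' s) (slope_v s)
  | Llet => Slopes (slope_d' s) (slope_v s) (slope_h s)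
  end.

(* Slopes of layer i.+1, that is, layers are numbered from 0 here.  The letters
   used are w_2, ..., w_(i.+1). *)
Definition layer_slopes (w : seq letter) (i : nat) : slopes :=
  foldl next_slopes slopes1 (take i (behead w)).

(* The punctures of S are the classes of Z^2 modulo Gamma, i.e. modulo 2 Z^2.
   A lattice parallelogram of area 1 has one corner in each class, so the
   vertices of all tetrahedra are labelled by punctures, and each of the four
   triangles of an ideal triangulation of S by three slopes is determined by
   the puncture which it misses. *)
Definition puncture (u : vec) : 'I_4 :=
  inord (odd `|u.1| + (odd `|u.2|).*2)%N.

Definition puncture_rep (k : 'I_4) : vec := (Posz (odd k), Posz k./2).

(* The other end of the edge of slope u ending at k. *)
Definition shift (u : vec) (k : 'I_4) : 'I_4 := puncture (puncture_rep k + u).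

(* In layer i, [(i, true)] is the tetrahedron whose outer faces share the edge
   of slope d_i joining the punctures of 0 and d_i, and [(i, false)] the one
   whose outer faces share the other edge of slope d_i, which joins the
   punctures of h_i and v_i.  Hence the triangle of the outer triangulation
   (slopes h_i, v_i, d_i) missing k is a face of [(i, outer_tet w i k)], and the
   triangle of the inner triangulation (slopes h_i, v_i, d_i') missing k is a
   face of [(i, ~~ outer_tet w i k)]. *)
Definition outer_tet (w : seq letter) (i : nat) (k : 'I_4) : bool :=
  (k == puncture (slope_h (layer_slopes w i))) ||
  (k == puncture (slope_v (layer_slopes w i))).

Definition outer_fold_slope (w : seq letter) : vec :=
  slope_v (layer_slopes w 0).

Definition inner_fold_slope (w : seq letter) : vec :=
  let s := layer_slopes w (size w).-2 in
  if is_R (last Rlet w) then slope_v s else slope_h s.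

(* Consecutive layers are glued by the identity of S.  Folding along the edges
   of slope u exchanges the triangles missing k and shift u k, fixing their two
   common vertices. *)
Definition sw_glue (w : seq letter) (t : 'I_(size w).-1 * bool) (k : 'I_4) :
    ('I_(size w).-1 * bool) * 'S_4 :=
  let: (i, b) := t in
  if b == outer_tet w i k then
    if i == 0%N :> nat then
      let k' := shift (outer_fold_slope w) k in
      ((i, outer_tet w i k'), tperm k k')
    else ((insubd i i.-1, ~~ outer_tet w i.-1 k), 1%g)
  else
    if i.+1 == (size w).-1 then
      let k' := shift (inner_fold_slope w) k in
      ((i, ~~ outer_tet w i k'), tperm k k')
    else ((insubd i i.+1, outer_tet w i.+1 k), 1%g).

Definition odd_vec (u : vec) : bool := odd `|u.1|%N || odd `|u.2|%N.

Lemma absz_oddD (x y : int) : odd `|(x + y)%R|%N = odd `|x|%N (+) odd `|y|%N.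
Proof. lia. Qed.

Lemma absz_oddN (x : int) : odd `|(- x)%R|%N = odd `|x|%N.
Proof. by rewrite abszN. Qed.

Lemma val_puncture u : puncture u = (odd `|u.1| + (odd `|u.2|).*2)%N :> nat.
Proof. by rewrite inordK //; case: (odd _); case: (odd _). Qed.

Lemma val_shift u k :
  shift u k =
    ((odd k (+) odd `|u.1|) + (odd k./2 (+) odd `|u.2|).*2)%N :> nat.
Proof.
rewrite /shift val_puncture /= !absz_oddD /=.
by case: (odd k).
Qed.

Lemma shiftK u : involutive (shift u).
Proof.
move=> k; apply: val_inj; rewrite /= !val_shift.
case: k => [[|[|[|[|//]]]] /= _].
all: by case: (odd `|u.1|); case: (odd `|u.2|).
Qed.

Lemma shift_neq u k : odd_vec u -> shift u k != k.
Proof.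
move=> ou; rewrite -val_eqE /= val_shift; move: ou; rewrite /odd_vec.
case: k => [[|[|[|[|//]]]] /= _].
all: by case: (odd `|u.1|); case: (odd `|u.2|).
Qed.

Lemma layer_slopes_odd w i :
  [/\ odd_vec (slope_h (layer_slopes w i)),
      odd_vec (slope_v (layer_slopes w i)) &
      odd_vec (slope_h (layer_slopes w i) + slope_v (layer_slopes w i))].
Proof.
rewrite /layer_slopes.
have : [/\ odd_vec (slope_h slopes1), odd_vec (slope_v slopes1) &
           odd_vec (slope_h slopes1 + slope_v slopes1)] by [].
elim: (take i (behead w)) slopes1 => [//|c s IHs] [[h1 h2] [v1 v2] d] hvd.
apply: IHs; move: hvd; rewrite /odd_vec.
case: c; rewrite /= /slope_d' /other_slope /=; case: ifP => _ /=; rewrite !(absz_oddD, absz_oddN).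
all: by case: (odd `|h1|); case: (odd `|h2|);
  case: (odd `|v1|); case: (odd `|v2|) => -[].
Qed.

Lemma outer_fold_odd w : odd_vec (outer_fold_slope w).
Proof. by case: (layer_slopes_odd w 0). Qed.

Lemma inner_fold_odd w : odd_vec (inner_fold_slope w).
Proof.
by rewrite /inner_fold_slope; case: ifP; case: (layer_slopes_odd w (size w).-2).
Qed.

Lemma sw_glueK w t k :
  sw_glue (@sw_glue w t k).1 ((sw_glue t k).2 k) =
  (t, ((sw_glue t k).2)^-1%g).
Proof.
case: t => i b; rewrite {2 3 4}/sw_glue.
case: ifP => [/eqP -> |bN].
  case: ifP => [i0|iN0] /=.
    by rewrite tpermL /sw_glue eqxx i0 shiftK tpermV tpermC.
  have lti : (i.-1 < (size w).-1)%N by apply: leq_ltn_trans (ltn_ord i); lia.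
  rewrite perm1 invg1 /sw_glue val_insubd lti.
  have -> : (~~ outer_tet w i.-1 k == outer_tet w i.-1 k) = false.
    by case: (outer_tet _ _ _).
  have ei : i.-1.+1 = i by rewrite prednK // lt0n iN0.
  rewrite ei ltn_eqF ?ltn_ord //; congr ((_, _), _).
  by apply: val_inj; rewrite /= val_insubd ltn_ord.
have -> : b = ~~ outer_tet w i k by case: (b) (outer_tet _ _ _) bN => [] [].
case: ifP => [i0|iN0] /=.
  rewrite tpermL /sw_glue.
  set c := outer_tet w i (shift _ _).
  have -> : (~~ c == c) = false by case: c.
  by rewrite i0 shiftK tpermV tpermC.
have lti : (i.+1 < (size w).-1)%N by rewrite ltn_neqAle iN0 ltn_ord.
rewrite perm1 invg1 /sw_glue val_insubd lti eqxx /=; congr ((_, _), _).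
by apply: val_inj; rewrite /= val_insubd ltn_ord.
Qed.

Lemma sw_glue_free w t k :
  ((@sw_glue w t k).1, (sw_glue t k).2 k) <> (t, k).
Proof.
case: t => i b; rewrite /sw_glue.
case: ifP => _; case: ifP => [|iN] /=.
- move=> _ [_]; rewrite tpermL => /eqP.
  by rewrite (negPf (shift_neq _ (outer_fold_odd w))).
- have lti : (i.-1 < (size w).-1)%N by apply: leq_ltn_trans (ltn_ord i); lia.
  case=> /(congr1 val); rewrite /= val_insubd lti => ei; move: iN; lia.
- move=> _ [_]; rewrite tpermL => /eqP.
  by rewrite (negPf (shift_neq _ (inner_fold_odd w))).
- have lti : (i.+1 < (size w).-1)%N by rewrite ltn_neqAle iN ltn_ord.
  by case=> /(congr1 val); rewrite /= val_insubd lti; lia.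
Qed.

Definition sakuma_weeks (w : seq letter) : triangulation :=
  Triangulation (@sw_glueK w) (@sw_glue_free w).

Lemma card_sakuma_weeks w : #|tet (sakuma_weeks w)| = ((size w).-1 * 2)%N.
Proof. by rewrite card_prod card_ord card_bool. Qed.

(* Main.v *)
(* If T = sakuma_weeks w is an ideal triangulation of M, then so is every
   triangulation obtained from T by bistellar moves, so it is enough to find
   moves which lower the number of tetrahedra, using only the combinatorics of
   T.  If a 1 >= 2, the edges of slope v_1 have degree three, two of the three
   tetrahedra being folded together in layer 1, and a 3-2 move applies; the
   case a n >= 2 is the same at the inner end.  If a i >= 3 with 1 < i < n, four
   consecutive layers share the slope h or the slope v.  An interior edge of
   degree four created in the first of them is surrounded by an octahedron; the
   4-4 move which changes its axis (a 2-3 move followed by a 3-2 move) lowers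
   the degree of an edge created in the second layer from four to three, and a
   3-2 move then removes that edge. *)

Require Import Defs.
From mathcomp Require Import all_boot all_order all_fingroup all_algebra.
From mathcomp Require Import zify lra.
From mathcomp Require Import all_classical all_reals all_analysis.
From mathcomp Require Import generic_quotient.
From Stdlib Require Import Relation_Operators.

Set Implicit Arguments.
Unset Strict Implicit.
Unset Printing Implicit Defensive.

Import Order.TTheory GRing.Theory Num.Theory.
Import numFieldNormedType.Exports.
Import Defs.

Local Open Scope classical_set_scope.
Local Open Scope ring_scope.
Local Open Scope quotient_scope.

(** The obstacle is that the bipyramid carrying a move need not be embedded: faces of its boundary
    may be glued to each other in T. The move is therefore made on abstract regions with boundary.
    The two decompositions of a bipyramid are compared by mutually inverse piecewise affine maps
    that are affine on each boundary face and match its vertices, so the pairing of boundary faces,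
    among themselves or with the rest of T, is transported unchanged. Since [identified] is
    generated by single face pairings, classes of edges are never computed: an edge of degree three
    appears only as three gluing equations between distinct tetrahedra. As the vertices are removed,
    the maps must also keep every barycentric coordinate below 1. In the Sakuma-Weeks triangulation
    the gluings depend on slopes only modulo 2, and a letter merely exchanges two of the three
    nonzero punctures. *)

(** * Topological preliminaries *)

Lemma homeomorphic_sym (X Y : topologicalType) :
  homeomorphic X Y -> homeomorphic Y X.
Proof. by case=> f [g [cf cg fK gK]]; exists g, f. Qed.

Lemma homeomorphic_trans (Y X Z : topologicalType) :
  homeomorphic X Y -> homeomorphic Y Z -> homeomorphic X Z.
Proof.
move=> [f [g [cf cg fK gK]]] [f' [g' [cf' cg' fK' gK']]].
exists (f' \o f), (g \o g'); split; try exact: can_comp.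
- by move=> x; apply: continuous_comp; [exact: cf|exact: cf'].
- by move=> x; apply: continuous_comp; [exact: cg'|exact: cg].
Qed.

(** Pasting lemma for finitely many closed sets. The local maps [g i] are continuous on all of [X],
    which is why the maps between tetrahedra below are total formulas. *)
Lemma continuous_closed_cover (X Z : topologicalType) (I : finType)
    (F : I -> set X) (f : X -> Z) (g : I -> X -> Z) :
  (forall i, closed (F i)) -> (forall x, exists i, F i x) ->
  (forall i, continuous (g i)) -> (forall i x, F i x -> f x = g i x) ->
  continuous f.
Proof.
move=> Fcl Fcov gc fg; apply/continuous_closedP => C Ccl.
have -> : f @^-1` C = \big[setU/set0]_(i <- enum I) (F i `&` g i @^-1` C).
  rewrite -bigcup_seq; apply/seteqP; split=> x /=.
    move=> Cfx; have [i Fix] := Fcov x.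
    by exists i; rewrite /= ?mem_enum//; split=> //; rewrite /= -(fg i).
  by move=> [i _ [Fix]] /=; rewrite -(fg i).
apply: closed_bigsetU => i _; apply: closedI => //.
by move/continuous_closedP: (gc i); exact.
Qed.

Lemma closed_cst (X : topologicalType) (b : bool) : closed [set _ : X | b].
Proof.
case: b.
  by rewrite (_ : [set _ | _] = setT); [exact: closedT|apply/seteqP; split].
by rewrite (_ : [set _ | _] = set0); [exact: closed0|apply/seteqP; split].
Qed.

(** * Points of an ideal tetrahedron *)

Section Coordinates.
Variable R : realType.

Definition simplex := set_type (@ideal_tetrahedron R).

Definition bcoord (x : simplex) (k : 'I_4) : R := (set_val x : 'rV[R]_4) 0 k.

Lemma mk_simplex_subproof (c : 'I_4 -> R) :
  (forall k, 0 <= c k < 1) /\ \sum_k c k = 1 -> ideal_tetrahedron (\row_k c k).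
Proof.
move=> [c01 c1]; split=> [k|]; first by rewrite mxE.
by rewrite -[RHS]c1; apply: eq_bigr => k _; rewrite mxE.
Qed.

Definition mk_simplex c c01 : simplex :=
  exist (fun y => y \in @ideal_tetrahedron R) _
    (mem_set (@mk_simplex_subproof c c01)).

Lemma bcoord_mk_simplex c c01 k : bcoord (@mk_simplex c c01) k = c k.
Proof. by rewrite /bcoord set_valE /= mxE. Qed.

Lemma bcoord_inj (x y : simplex) : bcoord x =1 bcoord y -> x = y.
Proof.
by move=> xy; apply: val_inj; apply/rowP => k; exact: xy.
Qed.

Lemma bcoord_ge0 x k : 0 <= bcoord x k.
Proof. by case: (set_valP x) => /(_ k)/andP[]. Qed.

Lemma bcoord_lt1 x k : bcoord x k < 1.
Proof. by case: (set_valP x) => /(_ k)/andP[]. Qed.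

Lemma sum_bcoord x : \sum_k bcoord x k = 1.
Proof. by case: (set_valP x). Qed.

Lemma bcoord_continuous k : continuous (bcoord^~ k).
Proof.
move=> x; apply: (continuous_comp (f := set_val) (g := fun y : 'rV[R]_4 => y 0 k)).
  exact: initial_continuous.
exact: coord_continuous.
Qed.

Lemma simplex_continuous (X : topologicalType) (f : X -> simplex) :
  (forall k, continuous (fun a => bcoord (f a) k)) -> continuous f.
Proof.
move=> fc; have vfc : continuous (set_val \o f : X -> 'rV[R]_4).
  move=> a A /= [P Pn PA].
  apply: (@filterS _ _ _ [set b | forall k, P 0 k (bcoord (f b) k)]).
    by move=> b Pb; apply: PA => i j; rewrite [i]ord1; exact: Pb.
  apply: filter_forall => k; exact: (fc k a _ (Pn 0 k)).
apply/continuousP => _ [B oB <-].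
by rewrite -comp_preimage; move/continuousP: vfc; exact.
Qed.

Lemma permute_subproof (s : 'S_4) (x : simplex) :
  (forall k, 0 <= bcoord x (s k) < 1) /\ \sum_k bcoord x (s k) = 1.
Proof.
split=> [k|]; first by rewrite bcoord_ge0 bcoord_lt1.
by rewrite -[RHS](sum_bcoord x) [RHS](reindex_inj (@perm_inj _ s)).
Qed.

Definition permute s x : simplex := mk_simplex (permute_subproof s x).

Lemma bcoord_permute s x k : bcoord (permute s x) k = bcoord x (s k).
Proof. exact: bcoord_mk_simplex. Qed.

Lemma permute_continuous s : continuous (permute s).
Proof.
apply: simplex_continuous => k.
have -> : (fun x => bcoord (permute s x) k) = bcoord^~ (s k).
  by apply/funext => x; exact: bcoord_permute.
exact: bcoord_continuous.
Qed.

Lemma permuteK s : cancel (permute s) (permute s^-1).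
Proof. by move=> x; apply: bcoord_inj => k; rewrite !bcoord_permute permKV. Qed.

End Coordinates.

(** * Piecewise defined homeomorphisms of realizations *)

Section PiecewiseHomeomorphism.
Variable R : realType.
Local Notation simplex := (simplex R).

Definition piece (T : triangulation) (t : tet T) (x : simplex) : pieces R T :=
  existT _ t x.

(** Only the generating relation [face_identified] is tested, and one pair of targets is enough,
    since [piecewise_overlap] identifies the images under all other choices. *)
Record piecewise (T T' : triangulation) := Piecewise {
  piecewise_dom : tet T -> tet T' -> set simplex;
  piecewise_map : tet T -> tet T' -> simplex -> simplex;
  piecewise_closed : forall t t', closed (piecewise_dom t t');
  piecewise_continuous : forall t t', continuous (piecewise_map t t');
  piecewise_cover : forall t x, exists t', piecewise_dom t t' x;
  piecewise_overlap : forall t x t1 t2, piecewise_dom t t1 x -> piecewise_dom t t2 x ->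
    identified (piece t1 (piecewise_map t t1 x)) (piece t2 (piecewise_map t t2 x));
  piecewise_glue : forall t x u y, face_identified (piece t x) (piece u y) ->
    exists t' u', [/\ piecewise_dom t t' x, piecewise_dom u u' y &
      identified (piece t' (piecewise_map t t' x)) (piece u' (piecewise_map u u' y))]
}.

Lemma identified_refl T (p : pieces R T) : identified p p.
Proof. by apply/asboolP; exact: rst_refl. Qed.

Lemma identified_sym T (p q : pieces R T) : identified p q -> identified q p.
Proof. by move/asboolP => pq; apply/asboolP; exact: rst_sym. Qed.

Lemma identified_trans T (q p r : pieces R T) :
  identified p q -> identified q r -> identified p r.
Proof.
by move=> /asboolP pq /asboolP qr; apply/asboolP; exact: rst_trans pq qr.
Qed.

Lemma identified_face T (p q : pieces R T) :
  face_identified p q -> identified p q.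
Proof. by move=> pq; apply/asboolP; exact: rst_step. Qed.

Lemma pi_realizationP T (p q : pieces R T) :
  \pi_(realization R T) p = \pi q <-> identified p q.
Proof. by split=> [/eqmodP|pq]; last exact/eqmodP. Qed.

Section PiecewiseMap.
Variables (T T' : triangulation) (P : piecewise T T').

Definition piecewise_target (p : pieces R T) : tet T' :=
  projT1 (cid (piecewise_cover P (projT1 p) (projT2 p))).

Definition piecewise_fun (p : pieces R T) : pieces R T' :=
  piece (piecewise_target p) (piecewise_map P (projT1 p) (piecewise_target p) (projT2 p)).

Lemma piecewise_funE t x t' : piecewise_dom P t t' x ->
  identified (piecewise_fun (piece t x)) (piece t' (piecewise_map P t t' x)).
Proof.
by move=> dx; apply: piecewise_overlap dx; rewrite /piecewise_target; case: cid.
Qed.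

Lemma piecewise_fun_identified p q :
  identified p q -> identified (piecewise_fun p) (piecewise_fun q).
Proof.
move/asboolP; elim=> {p q} [[t x] [u y] tu|p|p q _ pq|p q r _ pq _ qr].
- have [t' [u' [dt du tu']]] := piecewise_glue P tu.
  apply: identified_trans (piecewise_funE dt) _.
  exact: identified_trans tu' (identified_sym (piecewise_funE du)).
- exact: identified_refl.
- exact: identified_sym.
- exact: identified_trans pq qr.
Qed.

(** The function [piecewise_fun] may jump where domains overlap, because its target is chosen; the
    class of its value does not depend on the choice, so pasting applies after projection. *)
Lemma piecewise_fun_continuous : continuous (fun p => \pi_(realization R T') (piecewise_fun p)).
Proof.
move=> [t x]; apply: (sigT_continuous (fun (t : tet T) (x : simplex) =>
  \pi_(realization R T') (piecewise_fun (piece t x)))) => {x}t.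
apply: (continuous_closed_cover (F := piecewise_dom P t) (g := fun t' x =>
  \pi_(realization R T') (piece t' (piecewise_map P t t' x)))).
- exact: piecewise_closed.
- exact: piecewise_cover.
- move=> t' x; apply: continuous_comp; last exact: pi_continuous.
  apply: continuous_comp; [exact: piecewise_continuous|exact: existT_continuous].
- by move=> t' x dx; apply/pi_realizationP; exact: piecewise_funE.
Qed.

Definition piecewise_quot (p : realization R T) : realization R T' :=
  \pi_(realization R T') (piecewise_fun (repr p)).

Lemma piecewise_quotE p :
  piecewise_quot (\pi_(realization R T) p) = \pi_(realization R T') (piecewise_fun p).
Proof.
by apply/pi_realizationP/piecewise_fun_identified/pi_realizationP; rewrite reprK.
Qed.

Lemma piecewise_quot_continuous : continuous piecewise_quot.
Proof.
apply/quotient_continuous => p; rewrite /continuous_at.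
have -> : piecewise_quot \o \pi_(realization R T) =
    fun p => \pi_(realization R T') (piecewise_fun p).
  by apply/funext => q; exact: piecewise_quotE.
exact: piecewise_fun_continuous.
Qed.

End PiecewiseMap.

Definition piecewise_inverse T T' (P : piecewise T T') (P' : piecewise T' T) :=
  forall t t' x, piecewise_dom P t t' x ->
    piecewise_dom P' t' t (piecewise_map P t t' x) /\
    piecewise_map P' t' t (piecewise_map P t t' x) = x.

Lemma piecewise_quotK T T' (P : piecewise T T') (P' : piecewise T' T) :
  piecewise_inverse P P' -> cancel (piecewise_quot P) (piecewise_quot P').
Proof.
move=> PK p; have <- : \pi_(realization R T) (repr p) = p by rewrite reprK.
rewrite !piecewise_quotE; apply/pi_realizationP; case: (repr p) => t x.
have [t' dx] := piecewise_cover P t x; have [dx' xK] := PK _ _ _ dx.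
apply: identified_trans (piecewise_fun_identified P' (piecewise_funE dx)) _.
by have := piecewise_funE dx'; rewrite xK.
Qed.

Lemma piecewise_homeomorphic T T' (P : piecewise T T') (P' : piecewise T' T) :
  piecewise_inverse P P' -> piecewise_inverse P' P ->
  homeomorphic (realization R T) (realization R T').
Proof.
move=> PK P'K; exists (piecewise_quot P), (piecewise_quot P'); split.
- exact: piecewise_quot_continuous.
- exact: piecewise_quot_continuous.
- exact: piecewise_quotK.
- exact: piecewise_quotK.
Qed.

End PiecewiseHomeomorphism.

(** * Relabelling and replacing tetrahedra *)

Section Relabelling.
Variables (R : realType) (T : triangulation) (Q : finType).
Variables (e : Q -> tet T) (e' : tet T -> Q) (eps : Q -> 'S_4).
Hypotheses (eK : cancel e e') (e'K : cancel e' e).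

(** Products of permutations act from left to right: labels are translated by [eps q], carried
    across the face and translated back. This gives the cells to be replaced the labels of a
    region. *)
Definition relabel_glue (q : Q) (f : 'I_4) : Q * 'S_4 :=
  let us := glue (e q) (eps q f) in
  (e' us.1, (eps q * us.2 * (eps (e' us.1))^-1)%g).

Lemma relabel_glueK q f :
  relabel_glue (relabel_glue q f).1 ((relabel_glue q f).2 f) =
  (q, ((relabel_glue q f).2)^-1%g).
Proof.
rewrite /relabel_glue /= !permM e'K permKV glueK /= eK.
by rewrite !invMg invgK mulgA.
Qed.

Lemma relabel_glue_free q f :
  ((relabel_glue q f).1, (relabel_glue q f).2 f) <> (q, f).
Proof.
move=> [eq1 eq2]; apply: (@glue_free T (e q) (eps q f)).
congr pair; first by rewrite -[in RHS]eq1 e'K.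
by rewrite -[in RHS]eq2 !permM eq1 permKV.
Qed.

Definition relabel := Triangulation relabel_glueK relabel_glue_free.

Lemma relabel_piecewise_glue t (x : simplex R) u y :
  @face_identified R T (piece t x) (piece u y) ->
  exists t' u', [/\ t' == e' t, u' == e' u &
    identified (@piece R relabel t' (permute (eps t') x))
               (@piece R relabel u' (permute (eps u') y))].
Proof.
move=> [f [xf /= -> yx]]; do 2!eexists; split; [exact: eqxx|exact: eqxx|].
apply: identified_face; exists ((eps (e' t))^-1%g f); split.
- by rewrite [LHS]bcoord_permute permKV.
- by rewrite /= /relabel_glue e'K permKV.
move=> k; rewrite [LHS]bcoord_permute [RHS]bcoord_permute /= /relabel_glue !permM e'K !permKV.
exact: yx.
Qed.

Definition relabel_piecewise : piecewise R T relabel.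
Proof.
refine (@Piecewise R T relabel (fun t t' => [set x | t' == e' t])
  (fun t t' => permute (eps t')) _ _ _ _ relabel_piecewise_glue).
- by move=> t t'; exact: closed_cst.
- by move=> t t'; exact: permute_continuous.
- by move=> t x; exists (e' t) => /=.
- by move=> t x _ _ /eqP-> /eqP->; exact: identified_refl.
Defined.

Lemma relabel_inv_piecewise_glue q (x : simplex R) u y :
  @face_identified R relabel (piece q x) (piece u y) ->
  exists t' u', [/\ t' == e q, u' == e u &
    identified (@piece R T t' (permute (eps q)^-1 x))
               (@piece R T u' (permute (eps u)^-1 y))].
Proof.
move=> [f [xf /= -> yx]]; do 2!eexists; split; [exact: eqxx|exact: eqxx|].
apply: identified_face; exists (eps q f); split.
- by rewrite [LHS]bcoord_permute permK.
- by rewrite /= e'K.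
move=> k; rewrite [LHS]bcoord_permute [RHS]bcoord_permute.
by have := yx ((eps q)^-1%g k); rewrite /relabel_glue /= !permM permKV.
Qed.

Definition relabel_inv_piecewise : piecewise R relabel T.
Proof.
refine (@Piecewise R relabel T (fun t t' => [set x | t' == e t])
  (fun t t' => permute (eps t)^-1) _ _ _ _ relabel_inv_piecewise_glue).
- by move=> t t'; exact: closed_cst.
- by move=> t t'; exact: permute_continuous.
- by move=> t x; exists (e t) => /=.
- by move=> t x _ _ /eqP-> /eqP->; exact: identified_refl.
Defined.

Lemma relabel_homeomorphic :
  homeomorphic (realization R T) (realization R relabel).
Proof.
apply: (@piecewise_homeomorphic R _ _ relabel_piecewise relabel_inv_piecewise).
- by move=> t t' x /= /eqP->; rewrite e'K eqxx permuteK.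
- move=> t t' x /= /eqP->; rewrite eK eqxx.
  by rewrite -[X in permute X (_ _)]invgK permuteK.
Qed.

End Relabelling.

(** * Regions with boundary and their replacement *)

Definition gluing (Q : Type) := Q -> 'I_4 -> Q * 'S_4.

(* A triangulated 3-manifold with boundary; [inner_glue c f] is meaningful only
   when the face f of c is not on the boundary, that is, when [inner c f]. *)
Record region := Region {
  cell : finType;
  inner : cell -> 'I_4 -> bool;
  inner_glue : gluing cell;
  inner_glue_inner : forall c f, inner c f ->
    inner (inner_glue c f).1 ((inner_glue c f).2 f);
  inner_glueK : forall c f, inner c f ->
    inner_glue (inner_glue c f).1 ((inner_glue c f).2 f) =
    (c, ((inner_glue c f).2)^-1%g);
  inner_glue_free : forall c f, inner c f ->
    ((inner_glue c f).1, (inner_glue c f).2 f) <> (c, f)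
}.

(* One half of a homeomorphism between A and B which is affine on each boundary
   face: the face f of a is sent to the face [(bd a f).2 f] of [(bd a f).1], and
   [sub_dom a b] is the part of a mapped into b.  The value of [bd] at inner
   faces and of [sub_map] outside [sub_dom] is junk. *)
Record subdivision (R : realType) (A B : region) := Subdivision {
  bd : cell A -> 'I_4 -> cell B * 'S_4;
  bd_outer : forall a f, ~~ inner a f -> ~~ inner (bd a f).1 ((bd a f).2 f);
  sub_dom : cell A -> cell B -> set (simplex R);
  sub_map : cell A -> cell B -> simplex R -> simplex R;
  sub_closed : forall a b, closed (sub_dom a b);
  sub_continuous : forall a b, continuous (sub_map a b);
  sub_cover : forall a x, exists b, sub_dom a b x;
  sub_overlap : forall a x b1 b2, sub_dom a b1 x -> sub_dom a b2 x ->
    b1 = b2 \/ exists f, [/\ inner b1 f, bcoord (sub_map a b1 x) f = 0,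
      (inner_glue b1 f).1 = b2 & forall k,
      bcoord (sub_map a b2 x) ((inner_glue b1 f).2 k) =
      bcoord (sub_map a b1 x) k];
  sub_inner : forall a f x y, inner a f -> bcoord x f = 0 ->
    (forall k, bcoord y ((inner_glue a f).2 k) = bcoord x k) ->
    exists b, [/\ sub_dom a b x, sub_dom (inner_glue a f).1 b y &
      sub_map a b x = sub_map (inner_glue a f).1 b y];
  sub_bd : forall a f x, ~~ inner a f -> bcoord x f = 0 ->
    sub_dom a (bd a f).1 x /\
    forall k, bcoord (sub_map a (bd a f).1 x) ((bd a f).2 k) = bcoord x k
}.

Definition subdivision_inverse R A B
    (S : subdivision R A B) (S' : subdivision R B A) :=
  (forall a f, ~~ inner a f ->
    bd S' (bd S a f).1 ((bd S a f).2 f) = (a, ((bd S a f).2)^-1%g)) /\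
  (forall a b x, sub_dom S a b x ->
    sub_dom S' b a (sub_map S a b x) /\ sub_map S' b a (sub_map S a b x) = x).

Section Surgery.
Variables (R : realType) (O : finType).

Definition outer (A : region) (q : O + cell A) (f : 'I_4) : bool :=
  if q is inr a then ~~ inner a f else true.

Definition extends (A : region) (g : gluing (O + cell A)) :=
  forall a f, inner a f ->
    g (inr a) f = (inr (inner_glue a f).1, (inner_glue a f).2).

(* The face f of q in the old triangulation is the face [(transfer q f).2 f] of
   [(transfer q f).1] in the new one. *)
Definition transfer A B (S : subdivision R A B) (q : O + cell A) (f : 'I_4) :
    (O + cell B) * 'S_4 :=
  match q with
  | inl o => (inl o, 1%g)
  | inr a => (inr (bd S a f).1, (bd S a f).2)
  end.

(** Both ends of a pairing are transferred, so two boundary faces of the region glued to each other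
    are covered too. *)
Definition transfers A B (S : subdivision R A B)
    (g : gluing (O + cell A)) (g' : gluing (O + cell B)) :=
  forall q f, outer q f ->
    g' (transfer S q f).1 ((transfer S q f).2 f) =
    let us := g q f in
    let vr := transfer S us.1 (us.2 f) in
    (vr.1, (((transfer S q f).2)^-1 * us.2 * vr.2)%g).

Section Piecewise.
Variables (A B : region) (S : subdivision R A B).
Variables (g : gluing (O + cell A)).
Hypothesis gK : forall q f, g (g q f).1 ((g q f).2 f) = (q, ((g q f).2)^-1%g).
Hypothesis g_free : forall q f, ((g q f).1, (g q f).2 f) <> (q, f).
Variables (g' : gluing (O + cell B)).
Hypothesis gK' : forall q f, g' (g' q f).1 ((g' q f).2 f) = (q, ((g' q f).2)^-1%g).
Hypothesis g_free' : forall q f, ((g' q f).1, (g' q f).2 f) <> (q, f).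
Hypotheses (gA : extends g) (gB : extends g') (gg' : transfers S g g').
Let T := Triangulation gK g_free.
Let T' := Triangulation gK' g_free'.

(** Boundary faces of the region go to boundary faces by [bd_outer]; all faces of the untouched
    tetrahedra count as outer. *)
Lemma transfer_outer q f :
  outer q f -> outer (transfer S q f).1 ((transfer S q f).2 f).
Proof. by case: q => //= a; exact: bd_outer. Qed.

(** The gluing is an involution that pairs inner faces among themselves, so it cannot lead from an
    outer face to an inner one. *)
Lemma outer_glue q f : outer q f -> outer (g q f).1 ((g q f).2 f).
Proof.
move=> qf; have := gK q f; case: (g q f) => -[//|a] s /=.
move=> gaf; apply/negP => af; move: gaf qf; rewrite gA// => -[<- sE] /negP.
by apply; have := inner_glue_inner af; rewrite sE permK.
Qed.

Definition surgery_dom (t : tet T) (t' : tet T') : set (simplex R) :=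
  match t, t' with
  | inl o, inl o' => [set x | o == o']
  | inr a, inr b => sub_dom S a b
  | _, _ => set0
  end.

Definition surgery_map (t : tet T) (t' : tet T') (x : simplex R) :=
  match t, t' with inr a, inr b => sub_map S a b x | _, _ => x end.

Lemma surgery_overlap t x t1 t2 :
  surgery_dom t t1 x -> surgery_dom t t2 x ->
  identified (@piece R T' t1 (surgery_map t t1 x))
             (@piece R T' t2 (surgery_map t t2 x)).
Proof.
case: t t1 t2 => [c|a] [c1|b1] [c2|b2] //=.
  by move=> /eqP cc1 /eqP cc2; rewrite -cc1 -cc2; exact: identified_refl.
move=> d1 d2; have := sub_overlap d1 d2.
case=> [->|[f [b1f x0 b12 xE]]]; first exact: identified_refl.
by apply: identified_face; exists f; rewrite /= gB//= b12.
Qed.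

Lemma surgery_bd q f x : outer q f -> bcoord x f = 0 ->
  surgery_dom q (transfer S q f).1 x /\
  forall k, bcoord (surgery_map q (transfer S q f).1 x) ((transfer S q f).2 k) =
    bcoord x k.
Proof.
case: q => [c|a] /= af x0; last exact: sub_bd.
by split=> [|k]; rewrite ?perm1.
Qed.

(** Across an outer face the map is affine on both sides and [transfers] matches them; across an
    inner face the two points have the same image by [sub_inner]. *)
Lemma surgery_glue t x u y :
  face_identified (@piece R T t x) (@piece R T u y) ->
  exists t' u', [/\ surgery_dom t t' x, surgery_dom u u' y &
    identified (@piece R T' t' (surgery_map t t' x))
               (@piece R T' u' (surgery_map u u' y))].
Proof.
move=> [f [x0 /= -> yx]].
have [tf|] := boolP (outer t f).
  have y0 : bcoord y ((g t f).2 f) = 0 by rewrite [LHS]yx.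
  have [dx xE] := surgery_bd tf x0.
  have [dy yE] := surgery_bd (outer_glue tf) y0.
  do 2!eexists; split; [exact: dx|exact: dy|].
  apply: identified_face; exists ((transfer S t f).2 f).
  rewrite /= gg'//=; split=> [||k]; first by rewrite [LHS]xE.
    by [].
  rewrite !permM [LHS]yE [LHS]yx.
  by have := xE ((transfer S t f).2^-1%g k); rewrite permKV => xEk; rewrite [RHS]xEk.
case: t x0 yx => [//|a] /= x0 yx /negPn af.
rewrite gA//= in yx *.
have [b [dx dy xy]] := sub_inner S af x0 yx.
by exists (inr b), (inr b); split=> //=; rewrite xy; exact: identified_refl.
Qed.

Definition surgery_piecewise : piecewise R T T'.
Proof.
refine (@Piecewise R T T' surgery_dom surgery_map _ _ _ surgery_overlap surgery_glue).
- case=> [c|a] [c'|b]; rewrite /surgery_dom; try exact: closed0.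
    exact: closed_cst.
  exact: sub_closed.
- by case=> [c|a] [c'|b]; rewrite /surgery_map; try (by move=> x; exact: cvg_id);
    exact: sub_continuous.
- move=> [c|a] x; first by exists (inl c) => /=.
  by have [b] := sub_cover S a x; exists (inr b).
Defined.

End Piecewise.

Lemma transferK A B (S : subdivision R A B) (S' : subdivision R B A) q f :
  subdivision_inverse S S' -> outer q f ->
  transfer S' (transfer S q f).1 ((transfer S q f).2 f) =
  (q, ((transfer S q f).2)^-1%g).
Proof.
by case=> SK _; case: q => [c|a] /= af; rewrite ?invg1// SK.
Qed.

(** This lets the inverse homeomorphism come from the same construction with [A] and [B]
    exchanged. *)
Lemma transfers_sym A B (S : subdivision R A B) (S' : subdivision R B A)
    (g : gluing (O + cell A)) (g' : gluing (O + cell B)) :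
  (forall q f, g (g q f).1 ((g q f).2 f) = (q, ((g q f).2)^-1%g)) ->
  extends g -> subdivision_inverse S S' -> subdivision_inverse S' S ->
  transfers S g g' -> transfers S' g' g.
Proof.
move=> gK gA SS' S'S gg' q' f' /= qf'.
have qf := transfer_outer S' qf'.
have := gg' _ _ qf; rewrite (transferK S'S qf') /= permK => ->.
rewrite !permM invgK (transferK SS' (outer_glue gK gA qf)) /=.
by rewrite !mulgA mulVg mul1g mulgK; case: (g _ _).
Qed.

Section Glue.
Variables (A B : region) (S : subdivision R A B) (S' : subdivision R B A).
Hypotheses (SS' : subdivision_inverse S S') (S'S : subdivision_inverse S' S).
Variable g : gluing (O + cell A).
Hypothesis gK : forall q f, g (g q f).1 ((g q f).2 f) = (q, ((g q f).2)^-1%g).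
Hypothesis g_free : forall q f, ((g q f).1, (g q f).2 f) <> (q, f).
Hypothesis gA : extends g.

Definition outer_surgery_glue (q : O + cell B) (f : 'I_4) :=
  let pr := transfer S' q f in
  let us := g pr.1 (pr.2 f) in
  let vt := transfer S us.1 (us.2 (pr.2 f)) in
  (vt.1, (pr.2 * us.2 * vt.2)%g).

Definition surgery_glue_fun : gluing (O + cell B) := fun q f =>
  match q with
  | inr b => if inner b f then (inr (inner_glue b f).1, (inner_glue b f).2)
             else outer_surgery_glue q f
  | _ => outer_surgery_glue q f
  end.

Lemma surgery_glue_funE q f :
  outer q f -> surgery_glue_fun q f = outer_surgery_glue q f.
Proof. by case: q => //= b /negPf ->. Qed.

Lemma surgery_glue_extends : extends surgery_glue_fun.
Proof. by move=> b f /= ->. Qed.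

Lemma surgery_glue_transfers : transfers S g surgery_glue_fun.
Proof.
move=> q f qf; rewrite surgery_glue_funE; last exact: transfer_outer.
by rewrite /outer_surgery_glue (transferK SS' qf) /= permK.
Qed.

(** Every outer face of the new triangulation is the transfer of an old one, found through [S']; the
    new gluing then need only be checked on transferred faces, where it is a conjugate of [g]. *)
Lemma transfer_ind (P : O + cell B -> 'I_4 -> Prop) :
  (forall q f, outer q f -> P (transfer S q f).1 ((transfer S q f).2 f)) ->
  forall q f, outer q f -> P q f.
Proof.
move=> PS q f qf; have := PS _ _ (transfer_outer S' qf).
by rewrite (transferK S'S qf) /= permK.
Qed.

Lemma outerPn (q : O + cell B) f :
  ~~ outer q f -> exists2 b, q = inr b & inner b f.
Proof. by case: q => //= b /negPn bf; exists b. Qed.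

Lemma surgery_glue_funK q f :
  surgery_glue_fun (surgery_glue_fun q f).1 ((surgery_glue_fun q f).2 f) =
  (q, ((surgery_glue_fun q f).2)^-1%g).
Proof.
have [|/outerPn[b -> bf]] := boolP (outer q f); last first.
  by rewrite /= bf /= inner_glue_inner// inner_glueK.
move: q f; apply: transfer_ind => q f qf.
rewrite surgery_glue_transfers//= !permM permK.
have := surgery_glue_transfers (outer_glue gK gA qf); rewrite /= => ->.
by rewrite gK /= permK !invMg invgK !mulgA; case: (transfer _ _ _).
Qed.

Lemma surgery_glue_fun_free q f :
  ((surgery_glue_fun q f).1, (surgery_glue_fun q f).2 f) <> (q, f).
Proof.
have [|/outerPn[b -> bf]] := boolP (outer q f); last first.
  rewrite /= bf /= => -[ebb eff]; apply: (inner_glue_free bf).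
  by rewrite ebb eff.
move: q f; apply: transfer_ind => q f qf.
rewrite surgery_glue_transfers//= !permM permK => -[e1 e2].
apply: (@g_free q f).
have := transferK SS' (outer_glue gK gA qf); rewrite e1 e2.
rewrite (transferK SS' qf) => -[eq /invg_inj eS].
by congr pair; [rewrite -eq|apply: (@perm_inj _ (transfer S q f).2); rewrite [in LHS]eS].
Qed.

Lemma surgery_homeomorphic :
  homeomorphic (realization R (Triangulation gK g_free))
    (realization R (Triangulation surgery_glue_funK surgery_glue_fun_free)).
Proof.
pose P := surgery_piecewise gK g_free surgery_glue_funK surgery_glue_fun_free
  gA surgery_glue_extends surgery_glue_transfers.
pose P' := surgery_piecewise surgery_glue_funK surgery_glue_fun_free gK g_free
  surgery_glue_extends gA
  (transfers_sym gK gA SS' S'S surgery_glue_transfers).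
apply: (@piecewise_homeomorphic R _ _ P P').
- move=> [c|a] [c'|b] x //=; last by case: SS' => _; exact.
  by move=> /eqP ->; rewrite eqxx.
- move=> [c|a] [c'|b] x //=; last by case: S'S => _; exact.
  by move=> /eqP ->; rewrite eqxx.
Qed.

End Glue.

End Surgery.

(** * The two triangulations of a triangular bipyramid *)

Notation v0 := (@Ordinal 4 0 isT).
Notation v1 := (@Ordinal 4 1 isT).
Notation v2 := (@Ordinal 4 2 isT).
Notation v3 := (@Ordinal 4 3 isT).
Notation r0 := (@Ordinal 3 0 isT).
Notation r1 := (@Ordinal 3 1 isT).
Notation r2 := (@Ordinal 3 2 isT).

Lemma ord4P (P : 'I_4 -> Prop) : P v0 -> P v1 -> P v2 -> P v3 -> forall k, P k.
Proof.
move=> P0 P1 P2 P3 [[|[|[|[|//]]]] lt4];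
  [move: P0|move: P1|move: P2|move: P3]; congr P; exact: val_inj.
Qed.

Lemma ord3P (P : 'I_3 -> Prop) : P r0 -> P r1 -> P r2 -> forall i, P i.
Proof.
move=> P0 P1 P2 [[|[|[|//]]] lt3];
  [move: P0|move: P1|move: P2]; congr P; exact: val_inj.
Qed.

Lemma sum_ord4 (V : nmodType) (c : 'I_4 -> V) :
  \sum_k c k = c v0 + c v1 + c v2 + c v3.
Proof.
rewrite !big_ord_recr big_ord0 /= add0r.
by congr (_ + _ + _ + _); congr c; exact: val_inj.
Qed.

Definition eq_vertex (i : 'I_3) : 'I_4 := nth v0 [:: v0; v1; v2] i.

Definition eq_index (f : 'I_4) : 'I_3 := nth r0 [:: r0; r1; r2] f.

(* Two tetrahedra with equator v0, v1, v2 and with an apex at v3. *)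
Definition suspension_region : region.
Proof.
refine (@Region bool (fun _ f => f == v3) (fun b _ => (~~ b, 1%g)) _ _ _).
- by move=> b f /eqP ->; rewrite perm1.
- by move=> b f _ /=; rewrite negbK invg1.
- by move=> [] f _ /= [].
Defined.

(* Three tetrahedra around the edge joining the apices: tetrahedron i misses the
   equatorial vertex i, has the apex of [true] at v3, the apex of [false] at
   vertex i, and every other equatorial vertex at its own place. *)
Definition axis_region : region.
Proof.
refine (@Region 'I_3 (fun i f => (f != v3) && (f != eq_vertex i))
  (fun i f => (eq_index f, tperm (eq_vertex i) f)) _ _ _).
- by elim/ord3P => /=; elim/ord4P => //= _; rewrite !permE.
- by elim/ord3P => /=; elim/ord4P => //= _; rewrite !permE /= tpermV// tpermC.
- by elim/ord3P => /=; elim/ord4P => //= _; rewrite ?permE => -[].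
Defined.

Section BipyramidMaps.
Variable R : realType.
Local Notation simplex := (simplex R).

(** In cell [i] of the axis region the apices sit at [v3] and [eq_vertex i]; exchanging them for
    [false] puts apex [b] at [v3], so one formula serves both halves. *)
Definition apex_perm (b : bool) (i : 'I_3) : 'S_4 :=
  if b then 1%g else tperm (eq_vertex i) v3.

Lemma apex_permK b i k : apex_perm b i (apex_perm b i k) = k.
Proof. by case: b; rewrite /= ?perm1 ?tpermK. Qed.

Lemma minrP (a b : R) :
  [/\ Num.min a b <= a, Num.min a b <= b & Num.min a b = a \/ Num.min a b = b].
Proof. by case: (leP a b) => ab; split; lra. Qed.

Definition min_eq (c : 'I_4 -> R) : R := Num.min (c v0) (Num.min (c v1) (c v2)).

Lemma min_eqP c : [/\ min_eq c <= c v0, min_eq c <= c v1, min_eq c <= c v2 &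
  [\/ min_eq c = c v0, min_eq c = c v1 | min_eq c = c v2]].
Proof.
rewrite /min_eq; case: (leP (c v1) (c v2)) => c12;
  [case: (leP (c v0) (c v1)) => c0|case: (leP (c v0) (c v2)) => c0].
all: split; try lra.
all: by first [apply: Or31; lra|apply: Or32; lra|apply: Or33; lra].
Qed.

(* The bipyramid is placed so that the barycenter of the equator is the midpoint
   of the axis.  The coordinate [c k + 2^-1 * m] of the other apex is 3 / 2 * m on
   the subset [lowest i] where the map is used; this form keeps the map total,
   with values in the ideal tetrahedron. *)
Definition to_axis_coord (i : 'I_3) (c : 'I_4 -> R) (k : 'I_4) : R :=
  let m := min_eq c in
  if k == v3 then c v3 + 3 / 2 * m
  else if k == eq_vertex i then c k + 2^-1 * m
  else c k - m.

Lemma to_axis_subproof i (x : simplex) :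
  (forall k, 0 <= to_axis_coord i (bcoord x) k < 1) /\
  \sum_k to_axis_coord i (bcoord x) k = 1.
Proof.
have := sum_bcoord x; have [] := min_eqP (bcoord x).
have := bcoord_ge0 x v0; have := bcoord_ge0 x v1; have := bcoord_ge0 x v2.
have := bcoord_ge0 x v3.
have := bcoord_lt1 x v0; have := bcoord_lt1 x v1; have := bcoord_lt1 x v2.
have := bcoord_lt1 x v3.
rewrite !sum_ord4 => ? ? ? ? ? ? ? ? ? ? ? mE xE.
split; last by elim/ord3P: i; rewrite /to_axis_coord /=; lra.
by elim/ord3P: i; elim/ord4P; rewrite /to_axis_coord /=;
  case: mE => mE; apply/andP; split; lra.
Qed.

Definition to_axis i x : simplex := mk_simplex (to_axis_subproof i x).

(** The relation between axis and equator is read backwards: weight m at both apices is traded for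
    2/3 m at each equatorial vertex. When the far apex has the smaller weight m, [c k - 3^-1 * m]
    equals 2/3 m; the minimum keeps the map total. *)
Definition to_suspension_coord (i : 'I_3) (c : 'I_4 -> R) (k : 'I_4) : R :=
  let m := Num.min (c v3) (c (eq_vertex i)) in
  if k == v3 then c k - m
  else if k == eq_vertex i then c k - 3^-1 * m
  else c k + 2 / 3 * m.

Lemma to_suspension_subproof i (x : simplex) :
  (forall k, 0 <= to_suspension_coord i (bcoord x) k < 1) /\
  \sum_k to_suspension_coord i (bcoord x) k = 1.
Proof.
have := sum_bcoord x.
have := bcoord_ge0 x v0; have := bcoord_ge0 x v1; have := bcoord_ge0 x v2.
have := bcoord_ge0 x v3.
have := bcoord_lt1 x v0; have := bcoord_lt1 x v1; have := bcoord_lt1 x v2.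
have := bcoord_lt1 x v3.
rewrite !sum_ord4 => ? ? ? ? ? ? ? ? xE.
split; last by elim/ord3P: i; rewrite /to_suspension_coord /=; lra.
have := minrP (bcoord x v3) (bcoord x (eq_vertex i)).
by elim/ord3P: i => /= mP; elim/ord4P; rewrite /to_suspension_coord /=;
  case: mP => ? ? [] mE; apply/andP; split; lra.
Qed.

Definition to_suspension i x : simplex := mk_simplex (to_suspension_subproof i x).

Lemma continuous_minr (X : topologicalType) (f g : X -> R) :
  continuous f -> continuous g -> continuous (fun x => Num.min (f x) (g x)).
Proof.
by move=> fc gc x; apply: (@continuous_min R X f g x); [exact: fc|exact: gc].
Qed.

Lemma continuous_addr (X : topologicalType) (f g : X -> R) :
  continuous f -> continuous g -> continuous (fun x => f x + g x).
Proof. by move=> fc gc x; apply: cvgD; [exact: fc|exact: gc]. Qed.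

Lemma continuous_subr (X : topologicalType) (f g : X -> R) :
  continuous f -> continuous g -> continuous (fun x => f x - g x).
Proof. by move=> fc gc x; apply: cvgB; [exact: fc|exact: gc]. Qed.

Lemma continuous_mulr (X : topologicalType) (r : R) (g : X -> R) :
  continuous g -> continuous (fun x => r * g x).
Proof. by move=> gc x; apply: cvgM; [exact: cvg_cst|exact: gc]. Qed.

Lemma continuous_min_eq (X : topologicalType) (c : X -> 'I_4 -> R) :
  (forall k, continuous (c^~ k)) -> continuous (fun x => min_eq (c x)).
Proof.
move=> cc; apply: (continuous_minr (cc v0)).
exact: (continuous_minr (cc v1) (cc v2)).
Qed.

Lemma to_axis_continuous i : continuous (to_axis i).
Proof.
apply: simplex_continuous => k.
under eq_fun do rewrite bcoord_mk_simplex.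
have mc := continuous_min_eq (@bcoord_continuous R).
have kc := @bcoord_continuous R; rewrite /to_axis_coord.
case: (k == v3); first exact: (continuous_addr (kc v3) (continuous_mulr mc)).
case: (k == eq_vertex i); last exact: (continuous_subr (kc k) mc).
exact: (continuous_addr (kc k) (continuous_mulr mc)).
Qed.

Lemma to_suspension_continuous i : continuous (to_suspension i).
Proof.
apply: simplex_continuous => k.
under eq_fun do rewrite bcoord_mk_simplex.
have mc : continuous (fun x : simplex =>
    Num.min (bcoord x v3) (bcoord x (eq_vertex i))).
  exact: (continuous_minr (@bcoord_continuous R v3) (@bcoord_continuous R _)).
have kc := @bcoord_continuous R; rewrite /to_suspension_coord.
case: (k == v3); first exact: (continuous_subr (kc k) mc).
case: (k == eq_vertex i); last exact: (continuous_addr (kc k) (continuous_mulr mc)).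
exact: (continuous_subr (kc k) (continuous_mulr mc)).
Qed.

Lemma closed_bcoord_le k l : closed [set x : simplex | bcoord x k <= bcoord x l].
Proof.
have -> : [set x : simplex | bcoord x k <= bcoord x l] =
    (fun x => bcoord x l - bcoord x k) @^-1` [set r : R | 0 <= r].
  by apply/seteqP; split=> x /=; rewrite subr_ge0.
apply: closed_comp; last exact: closed_ge.
move=> x _; apply: continuous_subr; exact: bcoord_continuous.
Qed.

(** Equal weights of the equatorial vertices are traded for the apices until one of them is used up;
    that vertex is the one missing from the target cell. *)
Definition lowest (i : 'I_3) (x : simplex) : Prop :=
  forall j, bcoord x (eq_vertex i) <= bcoord x (eq_vertex j).

Lemma closed_lowest i : closed [set x | lowest i x].
Proof.
have -> : [set x | lowest i x] =
    \bigcap_j [set x | bcoord x (eq_vertex i) <= bcoord x (eq_vertex j)].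
  by apply/seteqP; split=> x /= lx j; [move=> _; exact: lx|exact: lx].
by apply: closed_bigI => j _; exact: closed_bcoord_le.
Qed.

Lemma lowest_exists x : exists i, lowest i x.
Proof.
have [m0 m1 m2 mE] := min_eqP (bcoord x).
case: mE => mE; [exists r0|exists r1|exists r2]; elim/ord3P => /=; lra.
Qed.

Lemma lowest_min i x : lowest i x -> min_eq (bcoord x) = bcoord x (eq_vertex i).
Proof.
move=> lx; have := lx r0; have := lx r1; have := lx r2.
by elim/ord3P: i {lx} => /=; have [? ? ? [] ?] := min_eqP (bcoord x); lra.
Qed.

Lemma lowest0 i x : bcoord x (eq_vertex i) = 0 -> lowest i x.
Proof. by move=> x0 j; rewrite x0 bcoord_ge0. Qed.

Lemma axis_overlap b x i1 i2 : lowest i1 x -> lowest i2 x ->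
  i1 = i2 \/ exists f, [/\ @inner axis_region i1 f,
    bcoord (permute (apex_perm b i1) (to_axis i1 x)) f = 0,
    (@inner_glue axis_region i1 f).1 = i2 &
    forall k, bcoord (permute (apex_perm b i2) (to_axis i2 x))
        ((@inner_glue axis_region i1 f).2 k) =
      bcoord (permute (apex_perm b i1) (to_axis i1 x)) k].
Proof.
move=> l1 l2; have m1 := lowest_min l1; have m2 := lowest_min l2.
have [->|i12] := eqVneq i1 i2; [by left|right].
(* Cell [i1] meets cell [i2] in its face opposite the equatorial vertex [i2]. *)
exists (eq_vertex i2); split.
- by elim/ord3P: i1 i12 {l1 m1}; elim/ord3P: i2 {l2 m2}.
- rewrite bcoord_permute bcoord_mk_simplex /to_axis_coord.
  by elim/ord3P: i1 i12 m1 {l1}; elim/ord3P: i2 m2 {l2} => //= -> // _ _;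
    case: b; rewrite !permE /= subrr.
- by elim/ord3P: i1 {i12 l1 m1}; elim/ord3P: i2 {l2 m2}.
move=> k; rewrite !bcoord_permute !bcoord_mk_simplex /to_axis_coord m1 /=.
have e12 : bcoord x (eq_vertex i1) = bcoord x (eq_vertex i2) by rewrite -m1 -m2.
elim/ord3P: i1 i12 e12 {l1 m1}; elim/ord3P: i2 {l2 m2} => //= _ e12.
all: by elim/ord4P: k; case: b; rewrite /= !permE /= ?permE /=; lra.
Qed.

Lemma permute_apexK b i : cancel (permute (apex_perm b i)) (permute (R := R) (apex_perm b i)).
Proof. by move=> x; apply: bcoord_inj => k; rewrite !bcoord_permute apex_permK. Qed.

(** On the equatorial triangle the apex coordinate vanishes, so both apices receive 3/2 m and
    exchanging them changes nothing. *)
Lemma axis_inner (b : bool) f x y : f == v3 -> bcoord x f = 0 ->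
  (forall k, bcoord y ((1 : 'S_4)%g k) = bcoord x k) ->
  exists i, [/\ lowest i x, lowest i y &
    permute (apex_perm b i) (to_axis i x) =
    permute (apex_perm (~~ b) i) (to_axis i y)].
Proof.
move=> /eqP -> x3 yx; have -> : y = x.
  by apply: bcoord_inj => k; rewrite -yx perm1.
have [i lx] := lowest_exists x; exists i; split=> //.
apply: bcoord_inj => k; rewrite !bcoord_permute !bcoord_mk_simplex.
have := lowest_min lx; rewrite /to_axis_coord => ->.
by elim/ord3P: i {lx}; elim/ord4P: k; case: b; rewrite /= !permE /=; lra.
Qed.

(** An equatorial coordinate vanishes on a boundary face, so the minimum is 0 and all corrections
    disappear. *)
Lemma axis_bd (b : bool) f x : f != v3 -> bcoord x f = 0 ->
  lowest (eq_index f) x /\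
  forall k, bcoord (permute (apex_perm b (eq_index f)) (to_axis (eq_index f) x))
    (apex_perm b (eq_index f) k) = bcoord x k.
Proof.
move=> f3 x0; have fE : eq_vertex (eq_index f) = f by elim/ord4P: f f3 {x0}.
have lx : lowest (eq_index f) x by apply: lowest0; rewrite fE.
split=> // k; rewrite bcoord_permute bcoord_mk_simplex apex_permK.
rewrite /to_axis_coord (lowest_min lx) fE x0 !mulr0 !addr0 subr0.
by case: eqP => [->|_]; last case: ifP.
Qed.

Definition axis_subdivision : subdivision R suspension_region axis_region.
Proof.
refine (@Subdivision R suspension_region axis_region
  (fun b f => (eq_index f, apex_perm b (eq_index f))) _
  (fun _ i => [set x | lowest i x])
  (fun b i x => permute (apex_perm b i) (to_axis i x))
  _ _ _ axis_overlap axis_inner axis_bd).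
- by case; elim/ord4P => //=; rewrite ?perm1 ?permE.
- by move=> _ i; exact: closed_lowest.
- move=> b i x; apply: continuous_comp; first exact: to_axis_continuous.
  exact: permute_continuous.
- by move=> _ x; have [i] := lowest_exists x; exists i.
Defined.

(** Apex [b] sits at [apex_perm b i v3] in cell [i], the other one at
    [apex_perm b i (eq_vertex i)]. *)
Definition nearer (i : 'I_3) (b : bool) (y : simplex) : Prop :=
  bcoord y (apex_perm b i (eq_vertex i)) <= bcoord y (apex_perm b i v3).

(** Equal apex weights cancel, which leaves a point of the equatorial triangle, the face opposite
    [v3] in both halves. *)
Lemma suspension_overlap i y b1 b2 : nearer i b1 y -> nearer i b2 y ->
  b1 = b2 \/ exists f, [/\ @inner suspension_region b1 f,
    bcoord (to_suspension i (permute (apex_perm b1 i) y)) f = 0,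
    (@inner_glue suspension_region b1 f).1 = b2 &
    forall k, bcoord (to_suspension i (permute (apex_perm b2 i) y))
        ((@inner_glue suspension_region b1 f).2 k) =
      bcoord (to_suspension i (permute (apex_perm b1 i) y)) k].
Proof.
rewrite /nearer => n1 n2; have [->|b12] := eqVneq b1 b2; [by left|right].
have e : bcoord y v3 = bcoord y (eq_vertex i).
  apply/eqP; rewrite eq_le; elim/ord3P: i n1 n2;
    by case: b1 b12; case: b2 => //= _; rewrite !permE /= => -> ->.
exists v3; split=> //.
- rewrite bcoord_mk_simplex /to_suspension_coord /= !bcoord_permute.
  by case: (b1); rewrite /= ?perm1 ?tpermL ?tpermR e minxx subrr.
- by case: b1 b12 {n1}; case: b2 {n2}.
move=> k; rewrite perm1 !bcoord_mk_simplex /to_suspension_coord !bcoord_permute.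
elim/ord3P: i e {n1 n2} => e; elim/ord4P: k; case: b1 b12; case: b2 => //= _.
all: by rewrite !permE /= ?e.
Qed.

(** The gluing around the axis carries the weight of each apex along, so the same apex is nearer on
    both sides. *)
Lemma suspension_inner i f x y :
  (f != v3) && (f != eq_vertex i) -> bcoord x f = 0 ->
  (forall k, bcoord y (tperm (eq_vertex i) f k) = bcoord x k) ->
  exists b, [/\ nearer i b x, nearer (eq_index f) b y &
    to_suspension i (permute (apex_perm b i) x) =
    to_suspension (eq_index f) (permute (apex_perm b (eq_index f)) y)].
Proof.
move=> /andP[f3 fi] x0 yx.
have yE k : bcoord y k = bcoord x (tperm (eq_vertex i) f k).
  by rewrite -yx tpermK.
have [b nb] : exists b, nearer i b x.
  rewrite /nearer; have [le|/ltW le] := leP (bcoord x (eq_vertex i)) (bcoord x v3).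
    by exists true; rewrite !perm1.
  by exists false; rewrite /= tpermL tpermR.
exists b; split=> //.
  move: nb; rewrite /nearer !yE; elim/ord3P: i fi {yx yE}; elim/ord4P: f f3 {x0} => //= _ _;
    by case: b; rewrite !permE /= ?permE /=.
apply: bcoord_inj => k; rewrite !bcoord_mk_simplex /to_suspension_coord.
rewrite !bcoord_permute !yE; move: nb x0; rewrite /nearer.
elim/ord3P: i fi {yx yE}; elim/ord4P: f f3 => //= _ _.
all: by elim/ord4P: k; case: b; rewrite /= !permE /= ?permE /= => le x0;
  rewrite (min_r le); lra.
Qed.

(** A boundary face lies in the half of the apex it contains: the face opposite [eq_vertex i] misses
    apex [false], the one opposite [v3] misses apex [true]. *)
Definition suspension_bd_fun (i : 'I_3) (f : 'I_4) : bool * 'S_4 :=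
  (f == eq_vertex i, apex_perm (f == eq_vertex i) i).

Lemma suspension_bd i f x :
  ~~ ((f != v3) && (f != eq_vertex i)) -> bcoord x f = 0 ->
  nearer i (suspension_bd_fun i f).1 x /\
  forall k, bcoord
      (to_suspension i (permute (apex_perm (suspension_bd_fun i f).1 i) x))
    ((suspension_bd_fun i f).2 k) = bcoord x k.
Proof.
rewrite -negb_or negbK /suspension_bd_fun /nearer /= => fi x0.
have xi : bcoord x (apex_perm (f == eq_vertex i) i (eq_vertex i)) = 0.
  by rewrite -[RHS]x0; congr bcoord; case/orP: fi => /eqP ->;
    rewrite ?eqxx /= ?perm1//; elim/ord3P: (i); rewrite /= tpermL.
have le := bcoord_ge0 x (apex_perm (f == eq_vertex i) i v3).
split=> [|k]; first by rewrite xi.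
rewrite bcoord_mk_simplex /to_suspension_coord !bcoord_permute xi (min_r le).
by rewrite !mulr0 !subr0 addr0 !if_same apex_permK.
Qed.

Definition suspension_subdivision : subdivision R axis_region suspension_region.
Proof.
refine (@Subdivision R axis_region suspension_region suspension_bd_fun _
  (fun i b => [set y | nearer i b y])
  (fun i b y => to_suspension i (permute (apex_perm b i) y))
  _ _ _ suspension_overlap suspension_inner suspension_bd).
- by elim/ord3P; elim/ord4P => //= _; rewrite ?perm1// permE.
- by move=> i b; exact: closed_bcoord_le.
- move=> i b y; apply: continuous_comp; first exact: permute_continuous.
  exact: to_suspension_continuous.
- move=> i y; rewrite /nearer.
  have [le|/ltW le] := leP (bcoord y (eq_vertex i)) (bcoord y v3).
    by exists true; rewrite /= !perm1.
  by exists false; rewrite /= tpermL tpermR.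
Defined.

Lemma axis_subdivisionK :
  subdivision_inverse axis_subdivision suspension_subdivision.
Proof.
split=> [b f|b i x /= lx].
  by elim/ord4P: f => //= _; rewrite /suspension_bd_fun; case: b;
    rewrite /= ?perm1 ?permE ?invg1 ?tpermV.
have mE := lowest_min lx.
have [m0 m1 m2 _] := min_eqP (bcoord x).
have x0 := bcoord_ge0 x v3.
rewrite permute_apexK; split.
  rewrite /nearer !bcoord_permute !apex_permK !bcoord_mk_simplex /to_axis_coord.
  by rewrite mE; elim/ord3P: i {lx mE} => /=; lra.
apply: bcoord_inj => k.
rewrite bcoord_mk_simplex /to_suspension_coord !bcoord_mk_simplex /to_axis_coord.
have le : bcoord x (eq_vertex i) + 2^-1 * min_eq (bcoord x) <=
   bcoord x v3 + 3 / 2 * min_eq (bcoord x) by rewrite mE; lra.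
by elim/ord3P: i mE le {lx} => /= mE le; elim/ord4P: k;
  rewrite /= (min_r le) mE; lra.
Qed.

Lemma suspension_subdivisionK :
  subdivision_inverse suspension_subdivision axis_subdivision.
Proof.
split=> [i f|i b y /=].
  by elim/ord3P: i; elim/ord4P: f => //= _; rewrite ?perm1 ?tpermL ?tpermR ?invg1 ?tpermV.
rewrite /nearer -!bcoord_permute -[X in permute _ _ = X](permute_apexK b i).
move: (permute _ y) => z le.
have le0 k := bcoord_ge0 z k.
have lz : lowest i (to_suspension i z).
  move=> j; rewrite !bcoord_mk_simplex /to_suspension_coord (min_r le).
  by elim/ord3P: i le; elim/ord3P: j => /= le;
    have := le0 v0; have := le0 v1; have := le0 v2; lra.
split=> //; congr permute; apply: bcoord_inj => k.
rewrite bcoord_mk_simplex /to_axis_coord (lowest_min lz).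
rewrite !bcoord_mk_simplex /to_suspension_coord (min_r le).
by elim/ord3P: i le {lz} => /= le; elim/ord4P: k => /=; lra.
Qed.

End BipyramidMaps.

(** * Surgery on a region found inside a triangulation *)

Section EmbeddedSurgery.
Variables (R : realType) (A B : region) (T : triangulation).
Variables (e : cell A -> tet T) (eps : cell A -> 'I_4 -> 'I_4).

(* [eps a] sends the vertices of the cell a of the region A to those of the
   tetrahedron [e a]. *)
Definition embedded : Prop :=
  [/\ injective e, forall a, injective (eps a) &
    forall a f, inner a f ->
      (glue (e a) (eps a f)).1 = e (inner_glue a f).1 /\
      forall k, (glue (e a) (eps a f)).2 (eps a k) =
        eps (inner_glue a f).1 ((inner_glue a f).2 k)].

(** This is what a further move has to know about T'. The value of [old_tet] is meaningful only
    outside [codom e]. *)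
Record surgered (bdf : cell A -> 'I_4 -> cell B * 'S_4) (T' : triangulation) := Surgered {
  old_tet : tet T -> tet T';
  new_tet : cell B -> tet T';
  surgered_homeomorphic : homeomorphic (realization R T) (realization R T');
  surgered_card : (#|tet T| + #|cell B| = #|tet T'| + #|cell A|)%N;
  new_tet_inj : injective new_tet;
  old_tet_inj : {in [predC codom e] &, injective old_tet};
  old_neq_new : forall t b, t \notin codom e -> old_tet t != new_tet b;
  glue_new : forall b f, inner b f ->
    glue (new_tet b) f = (new_tet (inner_glue b f).1, (inner_glue b f).2);
  glue_old : forall t f, t \notin codom e -> (glue t f).1 \notin codom e ->
    glue (old_tet t) f = (old_tet (glue t f).1, (glue t f).2);
  glue_bd : forall a f, ~~ inner a f -> (glue (e a) (eps a f)).1 \notin codom e ->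
    (glue (new_tet (bdf a f).1) ((bdf a f).2 f)).1 =
      old_tet (glue (e a) (eps a f)).1 /\
    forall k, (glue (new_tet (bdf a f).1) ((bdf a f).2 f)).2 ((bdf a f).2 k) =
      (glue (e a) (eps a f)).2 (eps a k)
}.

(** Relabelling T over the sum of the untouched tetrahedra and the cells of [A] makes the region a
    literal summand, which is then exchanged for [B]. *)
Lemma surgery_exists (S : subdivision R A B) (S' : subdivision R B A) :
  subdivision_inverse S S' -> subdivision_inverse S' S -> embedded ->
  exists T', inhabited (surgered (bd S) T').
Proof.
move=> SS' S'S [e_inj eps_inj e_glue].
pose O : finType := {t : tet T | t \notin codom e}.
pose ee (q : O + cell A) : tet T := match q with inl u => val u | inr a => e a end.
have ee_inj : injective ee.
  move=> [u|a] [v|b] /=; first by move/val_inj ->.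
  - by move=> uE; have := valP u; rewrite /= uE codom_f.
  - by move=> uE; have := valP v; rewrite /= -uE codom_f.
  - by move/e_inj ->.
have ee_card : (#|tet T| <= #|{: O + cell A}|)%N.
  by rewrite card_sum card_sig -(card_codom e_inj) addnC -(cardC (mem (codom e))).
have [e' eK e'K] := inj_card_bij ee_inj ee_card.
pose eps' (q : O + cell A) : 'S_4 :=
  match q with inl _ => 1%g | inr a => perm (eps_inj a) end.
have e'e a : e' (e a) = inr a by rewrite -[RHS]eK.
have e'old t : t \notin codom e -> exists2 u : O, e' t = inl u & val u = t.
  by move=> te; exists (exist _ t te); rewrite // -[RHS]eK.
have ext : @extends O A (relabel_glue ee e' eps').
  move=> a f af; have [g1 g2] := e_glue a f af.
  rewrite /relabel_glue /= permE g1 e'e; congr pair; apply/permP => k.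
  by rewrite !permM (permE (eps_inj a)) g2 -(permE (eps_inj _)) permK.
pose T' := Triangulation
  (surgery_glue_funK SS' S'S (relabel_glueK eps' eK e'K) ext)
  (surgery_glue_fun_free SS' S'S (relabel_glueK eps' eK e'K)
    (relabel_glue_free (eps := eps') e'K) ext).
exists T'; constructor.
(* The value on a replaced tetrahedron is an arbitrary new cell, there only to make [o] total. *)
pose o t : O + cell B :=
  match e' t with inl u => inl u | inr a => inr (bd S a v0).1 end.
apply: (@Surgered _ T' o (fun b => inr b)).
- apply: homeomorphic_trans (relabel_homeomorphic R eps' eK e'K) _.
  exact: surgery_homeomorphic.
- rewrite card_sum -(bij_eq_card (f := ee)) ?card_sum; last by exists e'.
  by rewrite addnAC.
- by move=> b b' [].
- move=> t t' /e'old[u eu uE] /e'old[u' eu' uE']; rewrite /o eu eu' => -[uu].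
  by rewrite -uE uu.
- by move=> t b /e'old[u eu _]; rewrite /o eu.
- by move=> b f /= ->.
- move=> t f /e'old[u eu uE] /e'old[u' eu' uE']; rewrite /o eu eu'.
  have gE : relabel_glue ee e' eps' (inl u) f = (inl u', (glue t f).2).
    by rewrite /relabel_glue /= perm1 uE eu' mul1g invg1 mulg1.
  have := @surgery_glue_transfers R O A B S S' SS' (relabel_glue ee e' eps') _ _
    (isT : outer (inl u : O + cell A) f).
  by rewrite gE /= invg1 perm1 mul1g mulg1.
- move=> a f af /e'old[u' eu' uE'].
  have gE : relabel_glue ee e' eps' (inr a) f =
      (inl u', (perm (eps_inj a) * (glue (e a) (eps a f)).2)%g).
    by rewrite /relabel_glue /= permE eu' invg1 mulg1.
  have := @surgery_glue_transfers R O A B S S' SS' (relabel_glue ee e' eps') _ _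
    (af : outer (inr a : O + cell A) f).
  rewrite gE /= => ->; rewrite /o eu'; split=> // k.
  by rewrite /= mulg1 !permM permK permE.
Qed.

End EmbeddedSurgery.

Definition tab (T : Type) (d : T) (s : seq T) (n : nat) (k : 'I_n) : T := nth d s k.

Lemma tab_inj (T : eqType) (d : T) (s : seq T) n :
  size s = n -> uniq s -> injective (@tab T d s n).
Proof.
move=> sn s_uniq i j /eqP; rewrite nth_uniq ?sn// => /eqP ij.
exact: val_inj.
Qed.

(** * Bistellar moves *)

Section Bistellar.
Variables (R : realType) (T : triangulation).

(** The 2-3 move. The common face is glued by the identity permutation, as between consecutive
    layers, so one labelling [eps] serves both halves. *)
Lemma suspension_surgery (e : bool -> tet T) (eps : 'I_4 -> 'I_4) :
  e true != e false -> injective eps ->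
  glue (e true) (eps v3) = (e false, 1%g) ->
  exists T', inhabited (@surgered R suspension_region axis_region T e
    (fun _ => eps) (bd (axis_subdivision R)) T').
Proof.
move=> e_neq eps_inj g.
apply: surgery_exists (axis_subdivisionK R) (suspension_subdivisionK R) _.
have g' : glue (e false) (eps v3) = (e true, 1%g).
  by have := glueK (e true) (eps v3); rewrite g /= perm1 invg1.
split=> //.
- move=> [] [] // e12; first by rewrite e12 eqxx in e_neq.
  by rewrite e12 eqxx in e_neq.
- by move=> [] f /= /eqP ->; rewrite ?g ?g' /=; split=> // k; rewrite !perm1.
Qed.

Definition around_axis (e : 'I_3 -> tet T) (eps : 'I_3 -> 'I_4 -> 'I_4)
    (i j : 'I_3) : Prop :=
  (glue (e i) (eps i (eq_vertex j))).1 = e j /\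
  forall k, (glue (e i) (eps i (eq_vertex j))).2 (eps i k) =
    eps j (tperm (eq_vertex i) (eq_vertex j) k).

Lemma around_axis_sym e eps i j : around_axis e eps i j -> around_axis e eps j i.
Proof.
rewrite {1}/around_axis; set f := eps i (eq_vertex j) => -[].
have := glueK (e i) f; case: (glue _ f) => u s /= gK uE sE.
have gE : glue (e j) (eps j (eq_vertex i)) = (e i, s^-1%g).
  have := sE (eq_vertex j); rewrite tpermR -uE => <-; exact: gK.
rewrite /around_axis gE; split=> // k; apply: (canLR (permK _)).
by rewrite sE tpermC tpermK.
Qed.

(** The 3-2 move. The six passages around the axis come in inverse pairs, so three of them are
    enough. *)
Lemma axis_surgery (e : 'I_3 -> tet T) (eps : 'I_3 -> 'I_4 -> 'I_4) :
  injective e -> (forall i, injective (eps i)) ->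
  around_axis e eps r0 r1 -> around_axis e eps r1 r2 ->
  around_axis e eps r2 r0 ->
  exists T', inhabited (@surgered R axis_region suspension_region T e eps
    (bd (suspension_subdivision R)) T').
Proof.
move=> e_inj eps_inj a01 a12 a20.
apply: surgery_exists (suspension_subdivisionK R) (axis_subdivisionK R) _.
have := around_axis_sym a01; have := around_axis_sym a12.
have := around_axis_sym a20 => a02 a21 a10.
split=> //; elim/ord3P; elim/ord4P; try by [].
all: by move=> _; assumption.
Qed.

(* The edge with ends c and d has degree three. *)
Lemma degree3_reduction (x y z : tet T) (a b c d : 'I_4) :
  uniq [:: x; y; z] -> uniq [:: a; b; c; d] ->
  glue x a = (y, tperm a b) -> glue x b = (z, 1%g) -> glue y a = (z, 1%g) ->
  exists2 T', homeomorphic (realization R T) (realization R T') &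
    (#|tet T'| < #|tet T|)%N.
Proof.
move=> xyz abcd gxa gxb gya.
pose e := @tab _ x [:: y; z; x] 3.
(* Each row places the axis at the apices of its cell: c at [v3], d at the vertex of the cell's own
   index. *)
pose eps (i : 'I_3) := @tab _ a (tab [::] [:: [:: d; a; b; c];
  [:: a; d; b; c]; [:: a; b; d; c]] i) 4.
have [] : exists T', inhabited (@surgered R axis_region suspension_region T e eps
    (bd (suspension_subdivision R)) T').
  have [ab ac ad] : [/\ a != b, a != c & a != d].
    by move: abcd; rewrite /= !inE !negb_or; case/and4P => /and3P[].
  have [bc bd cd] : [/\ b != c, b != d & c != d].
    by move: abcd; rewrite /= !inE !negb_or; case/and4P => _ /andP[].
  have gyb : glue y b = (x, tperm a b).
    by have := glueK x a; rewrite gxa /= tpermL tpermV.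
  apply: axis_surgery.
  - apply: tab_inj => //; move: xyz; rewrite /= !inE !negb_or.
    by rewrite (eq_sym z) (eq_sym y x) !andbT => /andP[/andP[-> ->] ->].
  - by elim/ord3P; apply: tab_inj => //; rewrite /tab /= !inE !negb_or
      ?(eq_sym d) ?(eq_sym b a) ab ac ad bc bd cd.
  - split; rewrite /eps /e /tab /= gya //.
    by elim/ord4P; rewrite /= perm1 !permE.
  - apply: around_axis_sym; split; rewrite /eps /e /tab /= gxb //.
    by elim/ord4P; rewrite /= perm1 !permE.
  - split; rewrite /eps /e /tab /= gxa //.
    by elim/ord4P; rewrite /= ?tpermL ?tpermR ?tpermD// !permE.
move=> T' [S]; exists T'; first exact: surgered_homeomorphic S.
by have := surgered_card S; rewrite /= card_ord card_bool; lia.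
Qed.

End Bistellar.

Lemma notin_codom (aT : finType) (rT : eqType) (e : aT -> rT) t :
  (forall a, t != e a) -> t \notin codom e.
Proof. by move=> te; apply/codomP => -[a ta]; have := te a; rewrite ta eqxx. Qed.

(** * The reduction across four layers *)

Section Twist.
Variables (R : realType) (T : triangulation).
Variables (t0 t1 u1 t2 u2 u3 : tet T) (p0 p1 p2 p3 : 'I_4).

(* The edge p1 p2 of t0 has degree four, with link p3 p0 p3 p0.  The 2-3 move on
   t0 and u1 creates an axis joining the two vertices p0 of the link, the 3-2
   move around p1 p2 then makes p1 p3 an edge of degree three, contained in t2,
   u3 and one new tetrahedron. *)
Lemma four_layer_reduction :
  uniq [:: t0; t1; u1; t2; u2; u3] -> uniq [:: p0; p1; p2; p3] ->
  glue t0 p0 = (u1, 1%g) -> glue t0 p3 = (t1, 1%g) ->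
  glue t1 p0 = (u2, 1%g) -> glue t1 p2 = (t2, 1%g) ->
  glue u1 p3 = (u2, 1%g) ->
  glue t2 p0 = (u3, 1%g) -> glue u2 p2 = (u3, 1%g) ->
  exists2 T', homeomorphic (realization R T) (realization R T') &
    (#|tet T'| < #|tet T|)%N.
Proof.
move=> t_uniq p_uniq g00 g03 g10 g12 g13 g20 g22.
have tn i j : (i < 6)%N -> (j < 6)%N -> i != j ->
    nth t0 [:: t0; t1; u1; t2; u2; u3] i != nth t0 [:: t0; t1; u1; t2; u2; u3] j.
  by move=> i6 j6; rewrite nth_uniq.
have pn i j : (i < 4)%N -> (j < 4)%N -> i != j ->
    nth p0 [:: p0; p1; p2; p3] i != nth p0 [:: p0; p1; p2; p3] j.
  by move=> i4 j4; rewrite nth_uniq.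
have ps := (pn 0 1 isT isT isT, pn 0 2 isT isT isT, pn 0 3 isT isT isT,
  pn 1 2 isT isT isT, pn 1 3 isT isT isT, pn 2 3 isT isT isT,
  pn 1 0 isT isT isT, pn 2 0 isT isT isT, pn 3 0 isT isT isT,
  pn 2 1 isT isT isT, pn 3 1 isT isT isT, pn 3 2 isT isT isT)%N.
rewrite /= in ps.
pose e1 (b : bool) := if b then t0 else u1.
pose eps1 := @tab _ p0 [:: p3; p1; p2; p0] 4.
have [||T1 [S1]] := @suspension_surgery R T e1 eps1 _ _ g00.
- exact: (tn 0 2)%N.
- by apply: tab_inj => //; rewrite /= !inE !negb_or !ps.
(* The cell [y] misses the equatorial vertex p3, so it contains p1 p2 and both apices; the edge p1
   p2 is now surrounded by [y], [t1] and [u2]. *)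
set o1 := old_tet S1; pose y := new_tet S1 r0.
have off_t1 : t1 \notin codom e1.
  by apply: notin_codom => -[]; [exact: (tn 1 0)%N|exact: (tn 1 2)%N].
have off_t2 : t2 \notin codom e1.
  by apply: notin_codom => -[]; [exact: (tn 3 0)%N|exact: (tn 3 2)%N].
have off_u2 : u2 \notin codom e1.
  by apply: notin_codom => -[]; [exact: (tn 4 0)%N|exact: (tn 4 2)%N].
have off_u3 : u3 \notin codom e1.
  by apply: notin_codom => -[]; [exact: (tn 5 0)%N|exact: (tn 5 2)%N].
have h10 : glue (o1 t1) p0 = (o1 u2, 1%g).
  by have := glue_old S1 (f := p0) off_t1; rewrite g10; exact.
have h12 : glue (o1 t1) p2 = (o1 t2, 1%g).
  by have := glue_old S1 (f := p2) off_t1; rewrite g12; exact.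
have h20 : glue (o1 t2) p0 = (o1 u3, 1%g).
  by have := glue_old S1 (f := p0) off_t2; rewrite g20; exact.
have h22 : glue (o1 u2) p2 = (o1 u3, 1%g).
  by have := glue_old S1 (f := p2) off_u2; rewrite g22; exact.
have [hy0 hy0E] : (glue y v0).1 = o1 t1 /\ forall k, (glue y v0).2 k = eps1 k.
  have := @glue_bd _ _ _ _ _ _ _ _ S1 true v0 isT.
  rewrite /= /eps1 /tab /= g03 perm1 => /(_ off_t1)[yE sE].
  by split=> // k; have := sE k; rewrite !perm1.
have [hy3 hy3E] : (glue y v3).1 = o1 u2 /\
    forall k, (glue y v3).2 (tperm v0 v3 k) = eps1 k.
  have := @glue_bd _ _ _ _ _ _ _ _ S1 false v0 isT.
  rewrite /= /eps1 /tab /= g13 tpermL => /(_ off_u2)[yE sE].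
  by split=> // k; have := sE k; rewrite !perm1.
(* The axis is p1 p2, with p1 at [v3]; these vertices are [v1] and [v2] in [y]. The equator reads
   p0, p3, p0. *)
pose e2 := @tab _ y [:: o1 u2; y; o1 t1] 3.
pose eps2 (i : 'I_3) := @tab _ p0 (tab [::] [:: [:: p2; p3; p0; p1];
  [:: v3; v2; v0; v1]; [:: p0; p3; p2; p1]] i) 4.
have o1_inj t t' : t \notin codom e1 -> t' \notin codom e1 -> t != t' ->
    o1 t != o1 t'.
  move=> te te'; apply: contra_neq => oo.
  exact: (@old_tet_inj _ _ _ _ _ _ _ _ S1 t t' te te' oo).
have o1y t : t \notin codom e1 -> o1 t != y by exact: (old_neq_new S1).
have [|||||T2 [S2]] := @axis_surgery R T1 e2 eps2 _ _ _ _ _.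
- apply: tab_inj => //; rewrite /= !inE !negb_or o1y// o1_inj//=; last exact: (tn 4 1)%N.
  by rewrite eq_sym o1y.
- by elim/ord3P; apply: tab_inj => //; rewrite /tab /= !inE !negb_or !ps.
- apply: around_axis_sym; split; first exact: hy3.
  elim/ord4P; rewrite permE.
  + by have := hy3E v0; rewrite permE.
  + by have := hy3E v2; rewrite permE.
  + by have := hy3E v3; rewrite permE.
  + by have := hy3E v1; rewrite permE.
- split; first exact: hy0.
  by elim/ord4P; rewrite permE; apply: (etrans (hy0E _)).
- split; first by rewrite [glue _ _]h10.
  by elim/ord4P; rewrite [glue _ _]h10 perm1 permE.
(* The half [z] has apex p1. Its vertices are p0, p3, p0, p1 in order, so p1 p3 is its edge from
   [v3] to [v1], and its faces [v2] and [v0] lead to [t2] and [u3]. *)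
set o2 := old_tet S2; pose z := new_tet S2 true.
have off_o1 t : t \notin codom e1 -> t != u2 -> t != t1 -> o1 t \notin codom e2.
  move=> te tu2 tt1; apply: notin_codom; elim/ord3P.
  - exact: o1_inj.
  - exact: o1y.
  - exact: o1_inj.
have off2_t2 : o1 t2 \notin codom e2.
  by apply: off_o1 => //; [exact: (tn 3 4)%N|exact: (tn 3 1)%N].
have off2_u3 : o1 u3 \notin codom e2.
  by apply: off_o1 => //; [exact: (tn 5 4)%N|exact: (tn 5 1)%N].
have k20 : glue (o2 (o1 t2)) p0 = (o2 (o1 u3), 1%g).
  by have := glue_old S2 (f := p0) off2_t2; rewrite h20; exact.
have [hz2 hz2E] : (glue z v2).1 = o2 (o1 t2) /\
    forall k, (glue z v2).2 k = eps2 r2 k.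
  have := @glue_bd _ _ _ _ _ _ _ _ S2 r2 v2 isT.
  rewrite [glue (e2 r2) _]h12 /= perm1 => /(_ off2_t2)[zE sE].
  by split=> // k; have := sE k; rewrite !perm1.
have [hz0 hz0E] : (glue z v0).1 = o2 (o1 u3) /\
    forall k, (glue z v0).2 k = eps2 r0 k.
  have := @glue_bd _ _ _ _ _ _ _ _ S2 r0 v0 isT.
  rewrite [glue (e2 r0) _]h22 /= perm1 => /(_ off2_u3)[zE sE].
  by split=> // k; have := sE k; rewrite !perm1.
have o2z t : t \notin codom e2 -> o2 t != z by exact: (old_neq_new S2).
have o2_neq : o2 (o1 u3) != o2 (o1 t2).
  have : o1 u3 != o1 t2 by apply: o1_inj => //; exact: (tn 5 3)%N.
  apply: contra_neq => oo.
  exact: (@old_tet_inj _ _ _ _ _ _ _ _ S2 _ _ off2_u3 off2_t2 oo).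
pose e3 := @tab _ z [:: o2 (o1 u3); o2 (o1 t2); z] 3.
pose eps3 (i : 'I_3) := @tab _ p0 (tab [::] [:: [:: p3; p0; p2; p1];
  [:: p0; p3; p2; p1]; [:: v0; v2; v1; v3]] i) 4.
have [|||||T3 [S3]] := @axis_surgery R T2 e3 eps3 _ _ _ _ _.
- by apply: tab_inj => //; rewrite /= !inE !negb_or o2_neq !o2z.
- by elim/ord3P; apply: tab_inj => //; rewrite /tab /= !inE !negb_or !ps.
- apply: around_axis_sym; split; first by rewrite [glue _ _]k20.
  by elim/ord4P; rewrite [glue _ _]k20 perm1 permE.
- apply: around_axis_sym; split; first exact: hz2.
  by elim/ord4P; rewrite permE; apply: (etrans (hz2E _)).
- split; first exact: hz0.
  by elim/ord4P; rewrite permE; apply: (etrans (hz0E _)).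
exists T3.
  apply: homeomorphic_trans (surgered_homeomorphic S1) _.
  apply: homeomorphic_trans (surgered_homeomorphic S2) _.
  exact: surgered_homeomorphic S3.
have := surgered_card S1; have := surgered_card S2; have := surgered_card S3.
by rewrite /= !card_ord !card_bool; lia.
Qed.

End Twist.

(** * The Sakuma-Weeks triangulation *)

Lemma puncture_eq (u v : vec) : odd `|u.1| = odd `|v.1| ->
  odd `|u.2| = odd `|v.2| -> puncture u = puncture v.
Proof. by move=> e1 e2; apply: val_inj; rewrite /= !val_puncture e1 e2. Qed.

Lemma shift_puncture (u v : vec) : shift u (puncture v) = puncture (v + u).
Proof.
apply: val_inj; rewrite /= val_shift !val_puncture /= !absz_oddD.
by case: (odd `|v.1|); case: (odd `|v.2|).
Qed.

Lemma puncture_addK u v : puncture (u + v + v) = puncture u.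
Proof. by apply: puncture_eq; rewrite /= !absz_oddD addbK. Qed.

Lemma puncture_addKC u v : puncture (u + u + v) = puncture v.
Proof. by apply: puncture_eq; rewrite /= !absz_oddD addbb. Qed.

(** The sum and the difference of [h] and [v] agree modulo 2, so the choice of Farey triangle is
    invisible at the punctures. *)
Lemma puncture_other h v d : puncture (other_slope h v d) = puncture (h + v).
Proof.
by rewrite /other_slope; case: ifP => // _;
  apply: puncture_eq; rewrite /= !absz_oddD ?absz_oddN.
Qed.

Definition layer_h w i := puncture (slope_h (layer_slopes w i)).
Definition layer_v w i := puncture (slope_v (layer_slopes w i)).
Definition layer_hv w i :=
  puncture (slope_h (layer_slopes w i) + slope_v (layer_slopes w i)).

Lemma layer_uniq w i : uniq [:: v0; layer_h w i; layer_v w i; layer_hv w i].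
Proof.
rewrite -(map_inj_uniq val_inj) /= /layer_h /layer_v /layer_hv !val_puncture.
have [] := layer_slopes_odd w i; rewrite /odd_vec /= !absz_oddD.
move: (slope_h _) (slope_v _) => [h1 h2] [x y] /=.
by case: (odd `|h1|); case: (odd `|h2|); case: (odd `|x|); case: (odd `|y|).
Qed.

(** With layers and letters both counted from 0, the passage from layer [i] to the next one reads
    the letter at position [i.+1]. *)
Lemma layer_slopesS w i : (i.+1 < size w)%N ->
  layer_slopes w i.+1 = next_slopes (layer_slopes w i) (nth Rlet w i.+1).
Proof.
by move=> ltiw; rewrite /layer_slopes (take_nth Rlet) ?size_behead;
  [rewrite foldl_rcons nth_behead|lia].
Qed.

Lemma layer_R w i : (i.+1 < size w)%N -> nth Rlet w i.+1 = Rlet ->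
  [/\ layer_h w i.+1 = layer_h w i, layer_v w i.+1 = layer_hv w i &
    layer_hv w i.+1 = layer_v w i].
Proof.
move=> ltiw wi; rewrite /layer_h /layer_v /layer_hv layer_slopesS// wi /=.
rewrite puncture_other; split=> //; rewrite /slope_d' /other_slope.
by case: ifP => _; apply: puncture_eq; rewrite /= !absz_oddD ?absz_oddN addKb.
Qed.

Lemma layer_L w i : (i.+1 < size w)%N -> nth Rlet w i.+1 = Llet ->
  [/\ layer_h w i.+1 = layer_hv w i, layer_v w i.+1 = layer_v w i &
    layer_hv w i.+1 = layer_h w i].
Proof.
move=> ltiw wi; rewrite /layer_h /layer_v /layer_hv layer_slopesS// wi /=.
rewrite puncture_other; split=> //; rewrite /slope_d' /other_slope.
by case: ifP => _; apply: puncture_eq;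
  rewrite /= !absz_oddD ?absz_oddN addbK.
Qed.

Lemma sw_glue_inward w (i j : 'I_(size w).-1) b k :
  j = i.+1 :> nat -> b != outer_tet w i k ->
  sw_glue (i, b) k = ((j, outer_tet w j k), 1%g).
Proof.
move=> ji /negPf bk; rewrite /sw_glue bk ltn_eqF; last by rewrite -ji ltn_ord.
by rewrite -ji valKd.
Qed.

Lemma sw_glue_outward w (i j : 'I_(size w).-1) k :
  j = i.+1 :> nat ->
  sw_glue (j, outer_tet w j k) k = ((i, ~~ outer_tet w i k), 1%g).
Proof. by move=> ji; rewrite /sw_glue eqxx ji /= valKd. Qed.

Lemma outer_tetE w i k : outer_tet w i k = (k == layer_h w i) || (k == layer_v w i).
Proof. by []. Qed.

(** * Reductions for the three kinds of long syllables *)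

Lemma reduction_start w (w0 : nth Rlet w 1 = Rlet) : (2 < size w)%N ->
  forall R : realType, exists2 T',
    homeomorphic (realization R (sakuma_weeks w)) (realization R T') &
    (#|tet T'| < #|tet (sakuma_weeks w)|)%N.
Proof.
move=> sz R.
have lt0 : (0 < (size w).-1)%N by lia.
have lt1 : (1 < (size w).-1)%N by lia.
pose i0 := Ordinal lt0; pose i1 := Ordinal lt1.
have lt1w : (1 < size w)%N by lia.
have [h1 v1E _] := layer_R lt1w w0.
have h0 : layer_h w 0 = v1 by apply: val_inj; rewrite /= val_puncture /layer_slopes take0.
have v0E : layer_v w 0 = v2 by apply: val_inj; rewrite /= val_puncture /layer_slopes take0.
have hv0 : layer_hv w 0 = v3 by apply: val_inj; rewrite /= val_puncture /layer_slopes take0.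
rewrite h0 in h1; rewrite hv0 in v1E.
have fold : shift (outer_fold_slope w) v1 = v3.
  by apply: val_inj; rewrite /= val_shift /outer_fold_slope /layer_slopes take0.
have gxa : sw_glue (i0, true) v1 = ((i0, false), tperm v1 v3).
  by rewrite /sw_glue !outer_tetE fold h0 v0E /=.
have gxb : sw_glue (i0, true) v3 = ((i1, true), 1%g).
  by rewrite (@sw_glue_inward w i0 i1) ?outer_tetE ?h0 ?v0E ?h1 ?v1E /=.
have gya : sw_glue (i0, false) v1 = ((i1, true), 1%g).
  by rewrite (@sw_glue_inward w i0 i1) ?outer_tetE ?h0 ?v0E ?h1 ?v1E /=.
(* The edge of degree three joins [v0] and [v2], the punctures of 0 and (0, 1); its slope is the
   folding slope. *)
exact: (@degree3_reduction R (sakuma_weeks w) (i0, true) (i0, false) (i1, true)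
  v1 v3 v0 v2 isT isT gxa gxb gya).
Qed.

Lemma reduction_end s c : (0 < size s)%N -> forall R : realType,
  let w := s ++ [:: c; c] in exists2 T',
    homeomorphic (realization R (sakuma_weeks w)) (realization R T') &
    (#|tet T'| < #|tet (sakuma_weeks w)|)%N.
Proof.
move=> s_gt0 R w.
have sw : size w = (size s).+2 by rewrite size_cat addn2.
(* Layers [m] and [m.+1] are the last two; the passage between them reads the penultimate letter,
   while the last letter chooses the folding slope. *)
have [m sm] : exists m, size s = m.+1 by exists (size s).-1; rewrite prednK.
have lt0 : (m < (size w).-1)%N by rewrite sw sm.
have lt1 : (m.+1 < (size w).-1)%N by rewrite sw sm.
have ltw : (m.+1 < size w)%N by rewrite sw sm; lia.
pose i0 := Ordinal lt0; pose i1 := Ordinal lt1.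
have wm : nth Rlet w m.+1 = c by rewrite /w nth_cat sm ltnn subnn.
have last1 : m.+2 == (size w).-1 by rewrite sw sm.
have fold : inner_fold_slope w =
    if is_R c then slope_v (layer_slopes w m.+1) else slope_h (layer_slopes w m.+1).
  by rewrite /inner_fold_slope {1}/w last_cat /= sw sm.
have uniq0 := layer_uniq w m.
have gxa a b : outer_tet w m.+1 a = false -> outer_tet w m.+1 b ->
    shift (inner_fold_slope w) a = b ->
    sw_glue (i1, true) a = ((i1, false), tperm a b).
  by move=> oa ob ab; rewrite /sw_glue [outer_tet w i1 a]oa /= last1 ab [outer_tet w i1 b]ob.
have gxb b : outer_tet w m.+1 b -> outer_tet w m b ->
    sw_glue (i1, true) b = ((i0, false), 1%g).
  move=> ob ob'; have := @sw_glue_outward w i0 i1 b erefl.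
  by rewrite [outer_tet w i1 b]ob [outer_tet w i0 b]ob'.
have gya a : outer_tet w m.+1 a = false -> outer_tet w m a ->
    sw_glue (i1, false) a = ((i0, false), 1%g).
  move=> oa oa'; have := @sw_glue_outward w i0 i1 a erefl.
  by rewrite [outer_tet w i1 a]oa [outer_tet w i0 a]oa'.
have tets_uniq : uniq [:: (i1, true); (i1, false); (i0, false)].
  by rewrite /= !inE !xpair_eqE /= -!val_eqE /= ?eqxx ?(gtn_eqF (ltnSn m)).
(* The degree-three edge joins puncture 0 to [d], which below is the puncture of the folding slope:
   [layer_hv w m] is the class of v in the last layer after R, of h after L. *)
have reduce a b d : outer_tet w m.+1 a = false -> outer_tet w m.+1 b ->
    outer_tet w m a -> outer_tet w m b -> shift (inner_fold_slope w) a = b ->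
    uniq [:: a; b; v0; d] -> exists2 T',
    homeomorphic (realization R (sakuma_weeks w)) (realization R T') &
    (#|tet T'| < #|tet (sakuma_weeks w)|)%N.
  move=> oa ob oa' ob' ab u.
  exact: (@degree3_reduction R (sakuma_weeks w) _ _ _ a b v0 d tets_uniq u
    (gxa _ _ oa ob ab) (gxb _ ob ob') (gya _ oa oa')).
move: uniq0; rewrite /= !inE !negb_or !andbT => /and3P[/and3P[n0h n0v n0d]].
move=> /andP[nhv nhd] nvd.
case: (c) wm fold => [wm fold|wm fold].
- have [hE vE dE] := layer_R ltw wm.
  apply: (reduce (layer_v w m) (layer_h w m) (layer_hv w m)).
  + by rewrite outer_tetE hE vE (negPf nvd) eq_sym (negPf nhv).
  + by rewrite outer_tetE hE eqxx.
  + by rewrite outer_tetE eqxx orbT.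
  + by rewrite outer_tetE eqxx.
  + by rewrite -dE fold shift_puncture puncture_addK -hE.
  + rewrite /= !inE !negb_or nvd nhd n0d (eq_sym _ v0) n0v (eq_sym _ v0) n0h.
    by rewrite eq_sym nhv.
- have [hE vE dE] := layer_L ltw wm.
  apply: (reduce (layer_h w m) (layer_v w m) (layer_hv w m)).
  + by rewrite outer_tetE hE vE (negPf nhd) (negPf nhv).
  + by rewrite outer_tetE vE eqxx orbT.
  + by rewrite outer_tetE eqxx.
  + by rewrite outer_tetE eqxx orbT.
  + by rewrite -dE fold shift_puncture addrAC puncture_addKC -vE.
  + by rewrite /= !inE !negb_or nvd nhd n0d nhv !(eq_sym _ v0) n0v n0h.
Qed.

(** Here p1 is the class of the slope shared by the four layers, while p2 and p3 alternate; stating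
    it by punctures treats R and L at once. The edge p1 p2 is the inner diagonal of [(m, true)], and
    p1 p3 that of [(m.+1, true)]. *)
Lemma four_layer_word w m p1 p2 p3 : (m.+4 < size w)%N ->
  uniq [:: v0; p1; p2; p3] ->
  (forall k, outer_tet w m k = (k == p1) || (k == p2)) ->
  (forall k, outer_tet w m.+1 k = (k == p1) || (k == p3)) ->
  (forall k, outer_tet w m.+2 k = (k == p1) || (k == p2)) ->
  (forall k, outer_tet w m.+3 k = (k == p1) || (k == p3)) ->
  forall R : realType, exists2 T',
    homeomorphic (realization R (sakuma_weeks w)) (realization R T') &
    (#|tet T'| < #|tet (sakuma_weeks w)|)%N.
Proof.
move=> ltm p_uniq o0 o1 o2 o3 R.
have lt0 : (m < (size w).-1)%N by lia.
have lt1 : (m.+1 < (size w).-1)%N by lia.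
have lt2 : (m.+2 < (size w).-1)%N by lia.
have lt3 : (m.+3 < (size w).-1)%N by lia.
pose i0 := Ordinal lt0; pose i1 := Ordinal lt1.
pose i2 := Ordinal lt2; pose i3 := Ordinal lt3.
have pn i j : (i < 4)%N -> (j < 4)%N ->
    (nth v0 [:: v0; p1; p2; p3] i == nth v0 [:: v0; p1; p2; p3] j) = (i == j).
  by move=> i4 j4; rewrite nth_uniq.
have ps := (pn 0 1 isT isT, pn 0 2 isT isT, pn 0 3 isT isT,
  pn 1 2 isT isT, pn 1 3 isT isT, pn 2 3 isT isT,
  pn 1 0 isT isT, pn 2 0 isT isT, pn 3 0 isT isT,
  pn 2 1 isT isT, pn 3 1 isT isT, pn 3 2 isT isT)%N.
rewrite /= in ps.
have g01 := @sw_glue_inward w i0 i1 _ _ erefl.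
have g12 := @sw_glue_inward w i1 i2 _ _ erefl.
have g23 := @sw_glue_inward w i2 i3 _ _ erefl.
have e0 k : outer_tet w i0 k = (k == p1) || (k == p2) := o0 k.
have e1 k : outer_tet w i1 k = (k == p1) || (k == p3) := o1 k.
have e2 k : outer_tet w i2 k = (k == p1) || (k == p2) := o2 k.
have e3 k : outer_tet w i3 k = (k == p1) || (k == p3) := o3 k.
apply: (@four_layer_reduction R (sakuma_weeks w) (i0, true) (i1, true)
  (i1, false) (i2, true) (i2, false) (i3, false) v0 p1 p2 p3 _ p_uniq).
- by rewrite /= !inE !xpair_eqE -!val_eqE /= ?eqxx; lia.
- by rewrite [LHS]g01 ?e0 ?e1 ?eqxx ?ps.
- by rewrite [LHS]g01 ?e0 ?e1 ?eqxx ?ps.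
- by rewrite [LHS]g12 ?e1 ?e2 ?eqxx ?ps.
- by rewrite [LHS]g12 ?e1 ?e2 ?eqxx ?ps.
- by rewrite [LHS]g12 ?e1 ?e2 ?eqxx ?ps.
- by rewrite [LHS]g23 ?e2 ?e3 ?eqxx ?ps.
- by rewrite [LHS]g23 ?e2 ?e3 ?eqxx ?ps.
Qed.

(** Three equal letters are three passages, hence four layers: a letter before them supplies the
    first layer and a letter after them the last. Repeating a letter twice restores the
    punctures. *)
Lemma reduction_middle s c s' : (0 < size s)%N -> (0 < size s')%N ->
  forall R : realType, let w := s ++ [:: c; c; c] ++ s' in exists2 T',
    homeomorphic (realization R (sakuma_weeks w)) (realization R T') &
    (#|tet T'| < #|tet (sakuma_weeks w)|)%N.
Proof.
move=> s_gt0 s'_gt0 R w.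
have sw : size w = ((size s).+3 + size s')%N by rewrite !size_cat /=; lia.
have [m sm] : exists m, size s = m.+1 by exists (size s).-1; rewrite prednK.
have wn k : (k < 3)%N -> nth Rlet w (m.+1 + k) = c.
  rewrite /w nth_cat sm (_ : (m.+1 + k < m.+1)%N = false); last by lia.
  by rewrite addKn; case: k => [|[|[|]]].
have w1 := wn 0 isT; have w2 := wn 1 isT; have w3 := wn 2 isT.
rewrite !addnS addn0 in w1 w2 w3.
have ltm : (m.+4 < size w)%N by rewrite sw sm; lia.
have lt1 : (m.+1 < size w)%N by lia.
have lt2 : (m.+2 < size w)%N by lia.
have lt3 : (m.+3 < size w)%N by lia.
have u := layer_uniq w m.
case: (c) w1 w2 w3 => w1 w2 w3.
- have [h1 x1 d1] := layer_R lt1 w1.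
  have [h2 x2 d2] := layer_R lt2 w2.
  have [h3 x3 d3] := layer_R lt3 w3.
  apply: (@four_layer_word w m (layer_h w m) (layer_v w m) (layer_hv w m)) => // k;
    by rewrite outer_tetE ?h3 ?x3 ?h2 ?d2 ?x2 ?h1 ?x1 ?d1.
- have [h1 x1 d1] := layer_L lt1 w1.
  have [h2 x2 d2] := layer_L lt2 w2.
  have [h3 x3 d3] := layer_L lt3 w3.
  apply: (@four_layer_word w m (layer_v w m) (layer_h w m) (layer_hv w m)) => //.
    rewrite -(perm_uniq (s1 := [:: v0; layer_h w m; layer_v w m; layer_hv w m]))//.
    by rewrite perm_cons (perm_catCA [:: _] [:: _]).
  all: by move=> k; rewrite outer_tetE orbC ?x3 ?h3 ?x2 ?d2 ?h2 ?x1 ?h1 ?d1.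
Qed.

(** * From reductions to the exponents *)

Lemma not_minimal (R : realType) (M : topologicalType) (T T' : triangulation) :
  homeomorphic (realization R T) (realization R T') ->
  (#|tet T'| < #|tet T|)%N -> ~ minimal_ideal_triangulation R M T.
Proof.
move=> TT' ltT [TM [_ minT]]; have := minT T'.
rewrite leqNgt ltT => /(_ _)/notF; apply.
exact: homeomorphic_trans (homeomorphic_sym TT') TM.
Qed.

Definition syllable_letter (i : nat) : letter := if odd i then Rlet else Llet.

Lemma alternating_word_cat n a i : (0 < i <= n)%N ->
  alternating_word n a =
  alternating_word i.-1 a ++ nseq (a i) (syllable_letter i) ++
  flatten [seq nseq (a j) (syllable_letter j) | j <- iota i.+1 (n - i)].
Proof.
move=> i_n; rewrite /alternating_word -[X in _ = _ ++ X]/(flatten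
  [seq nseq (a j) (syllable_letter j) | j <- i :: iota i.+1 (n - i)]).
rewrite -flatten_cat -map_cat; congr (flatten (map _ _)).
have nE : n = (i.-1 + (n - i).+1)%N by lia.
by rewrite {1}nE iotaD /= add1n prednK//; case/andP: i_n.
Qed.

Local Close Scope ring_scope.
Local Close Scope classical_set_scope.
Local Close Scope quotient_scope.

Theorem theorem11 (R : realType) (n : nat) (a : nat -> nat)
    (n_ge2 : 2 <= n)
    (a_gt0 : forall i : nat, 1 <= i <= n -> 0 < a i) :
  minimal_ideal_triangulation R
    (link_complement R (alternating_word n a))
    (sakuma_weeks (alternating_word n a)) ->
  [/\ a 1 = 1, a n = 1 &
      forall i : nat, 1 < i < n -> a i = 1 \/ a i = 2].
Proof.
move=> min.
have a1 := a_gt0 1; have an := a_gt0 n.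
have prefix_gt0 i : 1 < i <= n -> 0 < size (alternating_word i.-1 a).
  move=> i_n; rewrite (@alternating_word_cat i.-1 a 1); last by lia.
  by rewrite /= size_cat size_nseq addn_gt0 a1//; lia.
have w1 := @alternating_word_cat n a 1; have wn := @alternating_word_cat n a n.
split.
- apply/eqP; rewrite eqn_leq a1 ?andbT; last by lia.
  rewrite leqNgt; apply/negP => a1_gt1.
  have [||T' TT' ltT'] := @reduction_start (alternating_word n a) _ _ R.
  + by rewrite w1; [case: (a 1) a1_gt1 => [|[]]|lia].
  (* The second syllable supplies a third letter, hence a second layer. *)
  + rewrite (@alternating_word_cat n a 2); last by lia.
    rewrite /alternating_word /= cats0 !size_cat !size_nseq.
    by have := a_gt0 2; lia.
  exact: not_minimal TT' ltT' min.
- apply/eqP; rewrite eqn_leq an ?andbT; last by lia.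
  rewrite leqNgt; apply/negP => an_gt1.
  (* Surplus letters of the last syllable are moved into the prefix, which leaves exactly two at the
     end. *)
  have wE : alternating_word n a =
      (alternating_word n.-1 a ++ nseq (a n - 2) (syllable_letter n)) ++
      [:: syllable_letter n; syllable_letter n].
    rewrite wn; last by lia.
    by rewrite subnn cats0 -catA -(nseqD (a n - 2) 2) subnK.
  have [|T' TT' ltT'] := @reduction_end
    (alternating_word n.-1 a ++ nseq (a n - 2) (syllable_letter n))
    (syllable_letter n) _ R.
    by rewrite size_cat addn_gt0 prefix_gt0//; lia.
  by move: TT' ltT'; rewrite -wE => TT' ltT'; exact: not_minimal TT' ltT' min.
- move=> i i_n; have ai := a_gt0 i.
  have [ai_gt2|] := leqP 3 (a i); last by lia.
  exfalso; set c := syllable_letter i.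
  set s' := flatten [seq nseq (a j) (syllable_letter j) | j <- iota i.+1 (n - i)].
  have wE : alternating_word n a =
      (alternating_word i.-1 a ++ nseq (a i - 3) c) ++ [:: c; c; c] ++ s'.
    rewrite (@alternating_word_cat n a i); last by lia.
    rewrite -[in RHS]catA; congr (_ ++ _).
    by rewrite catA -(nseqD (a i - 3) 3) subnK.
  have s'_gt0 : 0 < size s'.
    rewrite /s' (_ : n - i = (n - i).-1.+1); last by lia.
    by rewrite /= size_cat size_nseq addn_gt0 a_gt0//; lia.
  have [|T' TT' ltT'] := @reduction_middle
    (alternating_word i.-1 a ++ nseq (a i - 3) c) c s' _ s'_gt0 R.
    by rewrite size_cat addn_gt0 prefix_gt0//; lia.
  by move: TT' ltT'; rewrite -wE => TT' ltT'; exact: not_minimal TT' ltT' min.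
Qed.
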